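(* Suppose $k_1\wedge k_2\ge2$. There exists a universal constant $c>0$ such that, for any integer $D\ge1$, $$\inf_{\widehat M\in\mathbb R[Y]^{n_1\times n_2}_{\le D}}\ \sup_{M\in\mathcal M_{k_1,k_2}}\ \mathbb E\big(\ell(\widehat M,M)\big)\ \ge\ \frac c{D^4}\left(\frac{k_1\wedge k_2}{n_1\vee n_2}\wedge\frac1{k_1\wedge k_2}\right).$$
   Context: $n_1,n_2,k_1,k_2$ are positive integers. The biclustering class is $$\mathcal M_{k_1,k_2}=\{M\in\mathbb R^{n_1\times n_2}: M_{ij}=Q_{(z_1)_i(z_2)_j}\ \text{for some } Q\in\mathbb R^{k_1\times k_2},\ z_1\in[k_1]^{n_1},\ z_2\in[k_2]^{n_2}\}.$$ One observes $Y=M+E$, where $E\in\mathbb R^{n_1\times n_2}$ has i.i.d. $N(0,1)$ entries; $\mathbb E$ is over $Y$ given $M$. The loss is $\ell(\widehat M,M)=\frac1{n_1n_2}\sum_{i\in[n_1],j\in[n_2]}(\widehat M_{ij}-M_{ij})^2$. The notation $\widehat M\in\mathbb R[Y]^{n_1\times n_2}_{\le D}$ means every entry $\widehat M_{ij}$ is a real polynomial of degree at most $D$ in the entries of $Y$. $a\wedge b=\min(a,b)$, $a\vee b=\max(a,b)$. ''Universal'' means not depending on $n_1,n_2,k_1,k_2,D$. *)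

(* Defs.v *)
From HB Require Import structures.
From mathcomp Require Import all_boot all_order all_algebra.
From mathcomp Require Import all_classical all_reals all_analysis.
(* The notations of mpoly clash with those of the analysis library, so only its
   coercions and canonical instances are imported. *)
From mathcomp Require mpoly.
Import (coercions, canonicals) mpoly.

Set Implicit Arguments.
Unset Strict Implicit.
Unset Printing Implicit Defensive.

Import Order.TTheory GRing.Theory Num.Theory.
Local Open Scope classical_set_scope.
Local Open Scope ring_scope.

Definition biclustering (R : realType) (n1 n2 k1 k2 : nat) :
    set 'M[R]_(n1, n2) :=
  [set M | exists (Q : 'M[R]_(k1, k2)) (z1 : 'I_n1 -> 'I_k1)
       (z2 : 'I_n2 -> 'I_k2), forall i j, M i j = Q (z1 i) (z2 j)].

Definition loss (R : realType) (n1 n2 : nat) (A B : 'M[R]_(n1, n2)) : R :=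
  (n1 * n2)%:R^-1 * \sum_(i < n1) \sum_(j < n2) (A i j - B i j) ^+ 2.

(* The n1 * n2 variables stand for the entries of Y, enumerated by mxvec.
   As msize is one more than the total degree (and 0 for the zero polynomial),
   msize p <= D.+1 says that p has total degree at most D. *)
Definition poly_estimator (R : realType) (n1 n2 D : nat) :
    set ('M[R]_(n1, n2) -> 'M[R]_(n1, n2)) :=
  [set Mhat | forall i j, exists p : mpoly.mpoly (n1 * n2) R,
     (mpoly.msize p <= D.+1)%N /\
     forall Y, Mhat Y i j = mpoly.meval (fun l => mxvec Y 0 l) p].

Definition mutually_independent (d : measure_display) (T : measurableType d)
    (R : realType) (P : probability T R) (I : finType)
    (X : I -> {RV P >-> R}) : Prop :=
  forall (J : {set I}) (B : I -> set R), (forall i, measurable (B i)) ->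
    P (\bigcap_(i in [set` J]) (X i @^-1` B i)) =
    (\prod_(i in J) P (X i @^-1` B i))%E.

(* Equality of laws is only required on measurable sets: the values of a
   measure elsewhere carry no meaning. *)
Definition iid_standard_normal (d : measure_display) (T : measurableType d)
    (R : realType) (P : probability T R) (I : finType)
    (X : I -> {RV P >-> R}) : Prop :=
  mutually_independent X /\
  forall i (A : set R), measurable A ->
    distribution P (X i) A = normal_prob 0 1 A.

Definition observation (d : measure_display) (T : measurableType d)
    (R : realType) (P : probability T R) (n1 n2 : nat)
    (E : 'I_n1 * 'I_n2 -> {RV P >-> R}) (M : 'M[R]_(n1, n2)) (w : T) :
    'M[R]_(n1, n2) :=
  M + \matrix_(i, j) E (i, j) w.

Definition risk (d : measure_display) (T : measurableType d)
    (R : realType) (P : probability T R) (n1 n2 : nat)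
    (E : 'I_n1 * 'I_n2 -> {RV P >-> R})
    (Mhat : 'M[R]_(n1, n2) -> 'M[R]_(n1, n2)) (M : 'M[R]_(n1, n2)) : \bar R :=
  'E_P[fun w => loss (Mhat (observation E M w)) M]%E.

(* Main.v *)
(* Put the uniform prior on labelings of the rows and columns by Z/k, with
   k = min k1 k2, and set M_ij = lam if i and j carry the same label, 0
   otherwise.  Write x for the entry of M to be estimated.  A random variable W
   that has the same correlation as x with every polynomial of degree at most D
   in Y certifies E (f(Y) - x)^2 >= E x^2 - E W^2 for all such f.  One takes
   W = sum_(|b| <= D) kappa_b / b! He_b(E), a function of the noise alone, where
   He_b is a product of Hermite polynomials and kappa_b is the joint cumulant
   of x and M^b; then E W^2 = sum_b kappa_b^2 / b!.

   The moment E M^b is lam^|b| times the probability p that all edges of the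
   bipartite graph of b join equal labels.  Each such event is a subgroup of
   the group of labelings, so p is supermultiplicative; this bounds
   |kappa_b| by lam^(|b|+1) (4 D)^|b| p.  Moreover kappa_b vanishes unless the
   graph of b is connected to the estimated entry, so that b can be grown edge
   by edge: an edge without new vertex can be chosen in at most D^2 ways, and
   an edge with one new vertex in at most D (n1 + n2) ways but divides p by k.
   Hence E W^2 is dominated by a geometric series as soon as
   lam^2 <= c D^-4 min(1, k^2 / n). *)

From HB Require Import structures.
From mathcomp Require Import all_boot all_order all_algebra all_fingroup.
From mathcomp Require Import ring lra zify.
Set Implicit Arguments.
Unset Strict Implicit.
Unset Printing Implicit Defensive.
Import Order.TTheory GRing.Theory Num.Theory.
Local Open Scope ring_scope.

(** * Cumulants of a multi-index *)

Section multiindex.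
Variables (I : finType) (D : nat).
Implicit Types a b : {ffun I -> 'I_D.+1}.

(** Exponents are capped at [D] only to make the multi-indices a finite type: one of total degree at
    most [D] never meets the cap. *)
Definition mdegree a : nat := (\sum_i a i)%N.
Definition mbin b a : nat := (\prod_i 'C(b i, a i))%N.
Definition mfact a : nat := (\prod_i (a i)`!)%N.

Lemma mfact_gt0 a : (0 < mfact a)%N.
Proof. by rewrite prodn_gt0// => i; exact: fact_gt0. Qed.

Lemma mbin_neq0 b a : mbin b a != 0%N -> forall i, (a i <= b i)%N.
Proof.
move=> + i; apply: contraNT; rewrite -ltnNge => ba.
by rewrite /mbin (bigD1 i)//= bin_small.
Qed.

Lemma mbin_self b : mbin b b = 1%N.
Proof. by rewrite /mbin big1// => i _; rewrite binn. Qed.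

(** Makes each nonzero term of the cumulant recursion one of strictly smaller degree, so that fuel
    above the degree suffices. *)
Lemma mbin_mdegree_lt a b : mbin b a != 0%N -> a != b -> (mdegree a < mdegree b)%N.
Proof.
move=> /mbin_neq0 le_ab ab.
have [i ai] : exists i, a i != b i.
  apply/existsP; apply: contraNT ab; rewrite negb_exists => /forallP ab.
  by apply/eqP/ffunP => i; apply/eqP; have := ab i; rewrite negbK.
rewrite /mdegree (bigD1 i)// [ltnRHS](bigD1 i)//= -addSn leq_add ?leq_sum//.
by rewrite ltn_neqAle ai le_ab.
Qed.

Variable R : realFieldType.
Variables amom mom : (I -> nat) -> R.

(* When [mom f = E M^f] and [amom f = E (x M^f)], [cumulant b] is the joint
   cumulant of [x] and the entries of [M^b].  Any fuel [n > mdegree b] gives the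
   same value. *)
Fixpoint cumulant_rec n b : R :=
  if n is n'.+1 then
    amom (fun i => b i : nat) -
      \sum_(a | a != b) (mbin b a)%:R * cumulant_rec n' a *
                         mom (fun i => b i - a i)%N
  else 0.

Definition cumulant b := cumulant_rec (mdegree b).+1 b.

Let cumulant_rec_fuel n m b : (mdegree b < n)%N -> (mdegree b < m)%N ->
  cumulant_rec n b = cumulant_rec m b.
Proof.
elim: n m b => [//|n IH] [//|m] b bn bm /=; congr (_ - _).
apply: eq_bigr => a ab; have [->|ba] := eqVneq (mbin b a) 0%N.
  by rewrite !mul0r.
congr (_ * _ * _); have lt_ab := mbin_mdegree_lt ba ab.
by apply: IH; exact: leq_trans lt_ab _.
Qed.

Lemma cumulantE b : cumulant b =
  amom (fun i => b i : nat) -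
    \sum_(a | a != b) (mbin b a)%:R * cumulant a * mom (fun i => b i - a i)%N.
Proof.
rewrite {1}/cumulant [LHS]/=; congr (_ - _); apply: eq_bigr => a ab.
have [->|ba] := eqVneq (mbin b a) 0%N; first by rewrite !mul0r.
congr (_ * _ * _); apply: cumulant_rec_fuel => //; exact: mbin_mdegree_lt.
Qed.

Hypothesis mom0 : forall g : I -> nat, (forall i, g i = 0%N) -> mom g = 1.

(** The moment-cumulant formula: its term [a = b] carries the moment of the zero exponent, which is
    1, and the recursion solves for that term. *)
Lemma sum_cumulant b : amom (fun i => b i : nat) =
  \sum_a (mbin b a)%:R * cumulant a * mom (fun i => b i - a i)%N.
Proof.
rewrite (bigD1 b)//= mbin_self mul1r mom0 ?mulr1; last by move=> i; rewrite subnn.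
by rewrite cumulantE subrK.
Qed.

End multiindex.

(** This numerical fact closes the induction that bounds cumulants by powers of [4 * D]. *)
Lemma expn_four_mul_succ_le D m : (m <= D)%N ->
  (1 + (4 * D).+1 ^ m <= 2 * (4 * D) ^ m)%N.
Proof.
case: D => [|D]; first by rewrite leqn0 => /eqP ->.
move=> mD; pose q := (4 * D.+1)%N.
(* This is [(1 + 1/q)^m <= 1/(1 - m/q)] without denominators; for [m <= D] and [q = 4 D] the right
   side is at most 4/3. *)
have step : (q.+1 ^ m * (q - m) <= q ^ m.+1)%N.
  have : (m <= q)%N by rewrite /q; lia.
  elim: {mD} m => [|m IH] mq; first by rewrite subn0 expn1 mul1n.
  have le_q : (q.+1 * (q - m.+1) <= q * (q - m))%N.
    by rewrite -(subnSK mq) mulSn mulnS leq_add ?leq_subr.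
  rewrite [leqRHS]expnS; apply: leq_trans (leq_mul (leqnn q) (IH (ltnW mq))).
  by rewrite expnS -mulnA [leqRHS]mulnCA [leqLHS]mulnCA leq_mul2l le_q orbT.
have [->//|m0] := posnP m.
(* As [m > 0], [q ^ m] is at least 4, so the extra 1 fits into the remaining two thirds of
   [q ^ m]. *)
have q_le : (q <= q ^ m)%N by rewrite -[X in (X <= _)%N]expn1 leq_exp2l// /q; lia.
have : (q.+1 ^ m * (3 * D.+1) <= q ^ m * q)%N.
  by rewrite -expnSr; apply: leq_trans step; rewrite leq_mul2l /q; apply/orP; right; lia.
rewrite -/q; move: q_le; rewrite /q; set A := (_ ^ m)%N; set B := (_ ^ m)%N.
by move=> *; nia.
Qed.

(** * Cumulants for an abstract edge probability: size, vanishing and summation *)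

Section cumulant_bounds.
Variables (R : realFieldType) (I : finType) (D : nat) (lam : R) (e0 : I).
Variables (p : {set I} -> R) (touch : rel I).
Hypothesis lam_ge0 : 0 <= lam.
Hypothesis p_ge0 : forall S, 0 <= p S.
Hypothesis p0 : p set0 = 1.
Hypothesis p_supermul : forall S T, p S * p T <= p (S :|: T).
Hypothesis p_indep : forall S T : {set I},
  (forall e f, e \in S -> f \in T -> ~~ touch e f) -> p (S :|: T) = p S * p T.

Local Notation mi := {ffun I -> 'I_D.+1}.
Implicit Types (a b : {ffun I -> 'I_D.+1}) (f : I -> nat).

Definition esupp f : {set I} := [set i | (0 < f i)%N].
(** When entries are [lam] times an indicator, a monomial sees its exponents only through the total
    degree and the support. *)
Definition edge_moment f : R := lam ^+ (\sum_i f i) * p (esupp f).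
Definition rooted_moment f : R := lam ^+ (\sum_i f i).+1 * p (e0 |: esupp f).

Local Notation kappa := (@cumulant I D R rooted_moment edge_moment).

Lemma edge_moment0 f : (forall i, f i = 0%N) -> edge_moment f = 1.
Proof.
move=> f0; rewrite /edge_moment big1// expr0 mul1r (_ : esupp f = set0)//.
by apply/setP => i; rewrite !inE f0.
Qed.

Let kappa_sum := @sum_cumulant I D R rooted_moment edge_moment edge_moment0.

(** The binomial theorem in each coordinate, multiplied out; indices [a] not below [b] contribute
    zero binomials. *)
Lemma sum_mbin_exp b (q : nat) :
  (\sum_a mbin b a * q ^ mdegree a = q.+1 ^ mdegree b)%N.
Proof.
rewrite /mdegree [RHS]expn_sum.
under [RHS]eq_bigr => i _.
  rewrite -addn1 addnC expnDn.
  rewrite (big_ord_widen D.+1 (fun j => 'C(b i, j) * (1 ^ (b i - j) * q ^ j))%N)//.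
  rewrite big_mkcond.
  over.
rewrite bigA_distr_bigA/=; apply: eq_bigr => a _.
rewrite expn_sum /mbin -big_split/=; apply: eq_bigr => i _.
by case: ltnP => [_|ba]; rewrite ?exp1n ?mul1n// bin_small.
Qed.

(** Strong induction on the degree along the recursion: supermultiplicativity recombines the two
    probabilities in each term, and the binomial sum that remains is absorbed by the factor
    [4 * D]. *)
Lemma norm_cumulant_le b : (mdegree b <= D)%N ->
  `|kappa b| <= lam ^+ (mdegree b).+1 * (4 * D)%:R ^+ mdegree b *
                p (e0 |: esupp (fun i => b i)).
Proof.
have [n] := ubnP (mdegree b); elim: n b => // n IH b bn bD.
rewrite cumulantE; apply: le_trans (ler_normB _ _) _.
set pb := p (e0 |: _); set m := mdegree b; have pb_ge0 : 0 <= pb by exact: p_ge0.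
have -> : `|rooted_moment (fun i => b i)| = lam ^+ m.+1 * pb.
  by rewrite /rooted_moment ger0_norm// mulr_ge0// exprn_ge0.
have le_term a : a != b ->
    `|(mbin b a)%:R * kappa a * edge_moment (fun i => b i - a i)%N| <=
    (mbin b a * (4 * D) ^ mdegree a)%:R * (lam ^+ m.+1 * pb).
  move=> ab; have [->|ba] := eqVneq (mbin b a) 0%N.
    by rewrite !mul0r normr0.
  have deg_ab := mbin_mdegree_lt ba ab; have le_ab := mbin_neq0 ba.
  rewrite 2!normrM normr_nat natrM -!mulrA ler_wpM2l//.
  rewrite (_ : `|edge_moment _| =
    lam ^+ (m - mdegree a) * p (esupp (fun i => b i - a i)%N)); last first.
    rewrite ger0_norm ?mulr_ge0 ?exprn_ge0// /edge_moment; congr (_ ^+ _ * _).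
    by rewrite /m /mdegree sumnB.
  apply: le_trans (ler_wpM2r _ (IH a _ _)) _.
  - by rewrite mulr_ge0// exprn_ge0.
  - by apply: leq_trans deg_ab _.
  - by apply: leq_trans (ltnW deg_ab) _.
  have -> : lam ^+ m.+1 = lam ^+ (mdegree a).+1 * lam ^+ (m - mdegree a).
    by rewrite -exprD; congr (_ ^+ _); rewrite /m; lia.
  rewrite natrX [leLHS](_ : _ = (4 * D)%:R ^+ mdegree a * (lam ^+ (mdegree a).+1 *
    lam ^+ (m - mdegree a) * (p (e0 |: esupp (fun i => a i)) *
    p (esupp (fun i => b i - a i)%N)))); last by ring.
  rewrite ler_wpM2l ?exprn_ge0// ler_wpM2l ?mulr_ge0 ?exprn_ge0//.
  (* For [a] below [b], the supports of [a] and [b - a] together cover exactly that of [b]. *)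
  apply: le_trans (p_supermul _ _) _; rewrite /pb le_eqVlt; apply/orP; left.
  apply/eqP; congr p; rewrite -setUA; congr (_ :|: _); apply/setP => i; rewrite !inE.
  by have := le_ab i; lia.
have le_sum : `|\sum_(a | a != b) (mbin b a)%:R * kappa a * edge_moment (fun i => b i - a i)%N|
    <= (((4 * D).+1 ^ m)%:R - ((4 * D) ^ m)%:R) * (lam ^+ m.+1 * pb).
  apply: le_trans (ler_norm_sum _ _ _) _; apply: le_trans (ler_sum _ le_term) _.
  rewrite -mulr_suml ler_wpM2r ?mulr_ge0 ?exprn_ge0//.
  rewrite /m -(sum_mbin_exp b (4 * D)) [in leRHS](bigD1 b)//= mbin_self mul1n natrD natr_sum.
  by rewrite addrAC subrr add0r.
apply: le_trans (lerD (lexx _) le_sum) _.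
rewrite -{1}[lam ^+ m.+1 * pb]mul1r -mulrDl mulrAC mulrC ler_wpM2l ?mulr_ge0 ?exprn_ge0//.
have := expn_four_mul_succ_le bD; rewrite -/m -(ler_nat R) natrD natrM -natrX.
by move: ((4 * D).+1 ^ m)%N%:R ((4 * D) ^ m)%N%:R => u v; lra.
Qed.

Local Notation supp b := (esupp (fun i => b i : nat)).

(** A joint cumulant vanishes when its variables split into two independent groups. By induction,
    only the [a] that avoid [T] survive in the recursion, and their sum factors over [S] and [T]. *)
Lemma cumulant_disconnected b (S T : {set I}) : e0 \in S ->
  (forall e e', e \in S -> e' \in T -> ~~ touch e e') ->
  supp b \subset S :|: T -> supp b :&: T != set0 -> kappa b = 0.
Proof.
move=> e0S ST; have [n] := ubnP (mdegree b); elim: n b => // n IH b bn bST bT.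
pose bS : mi := [ffun i => if i \in T then ord0 else b i].
pose bT' i : nat := if i \in T then nat_of_ord (b i) else 0%N.
(* If [a] avoids [T], the moment of [b - a] splits by independence. If [a] meets [T], the right side
   has a zero binomial and the left side vanishes by induction or by its own binomial. *)
have term a : a != b -> (mbin b a)%:R * kappa a * edge_moment (fun i => b i - a i)%N =
    (mbin bS a)%:R * kappa a * edge_moment (fun i => bS i - a i)%N * edge_moment bT'.
  move=> ab; have [aT|/forallPn[i]] := boolP [forall i, (i \in T) ==> (a i == 0%N :> nat)].
    have {}aT i : i \in T -> a i = 0%N :> nat.
      by move=> iT; apply/eqP; exact: (forall_inP aT).
    have -> : mbin b a = mbin bS a.
      by apply: eq_bigr => i _; rewrite ffunE; case: ifP => // /aT ->; rewrite !bin0.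
    rewrite -mulrA -[RHS]mulrA -[RHS]mulrA; congr (_ * (_ * _)).
    rewrite /edge_moment mulrACA -exprD -big_split/=; congr (_ ^+ _ * _).
      apply: eq_bigr => i _; rewrite ffunE /bT'; case: ifP => [/aT ->|_] /=; lia.
    rewrite -p_indep.
      congr p; apply/setP => i; rewrite !inE ffunE /bT'.
      by case: ifP => [/aT ->|_] /=; lia.
    move=> e f; rewrite !inE ffunE /bT'; case: ifPn => // eT be.
    case: ifP => // fT _; apply: ST => //.
    move/subsetP: bST => /(_ e); rewrite !inE (negPf eT) orbF; apply; lia.
  rewrite negb_imply -lt0n => /andP[iT ai].
  have -> : mbin bS a = 0%N by rewrite /mbin (bigD1 i)//= ffunE iT bin_small.
  have [->|ba] := eqVneq (mbin b a) 0%N; first by rewrite !mul0r.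
  rewrite [kappa a]IH ?mulr0 ?mul0r//.
  - by apply: leq_trans (mbin_mdegree_lt ba ab) _.
  - apply: subset_trans bST; apply/subsetP => j; rewrite !inE => aj.
    exact: leq_trans aj (mbin_neq0 ba j).
  - by apply/set0Pn; exists i; rewrite !inE ai.
rewrite cumulantE (eq_bigr _ term) -mulr_suml.
(* The excluded term [a = b] would be zero, since [b] meets [T] and [bS] does not; the sum is thus
   the full moment-cumulant formula of [bS]. *)
rewrite [X in _ - X * _](_ : _ = rooted_moment (fun i => bS i)); last first.
  rewrite kappa_sum [RHS](bigD1 b)//= [X in X%:R * _](_ : mbin bS b = 0%N) ?mul0r ?add0r//.
  have /set0Pn[i] := bT; rewrite !inE => /andP[bi iT].
  by rewrite /mbin (bigD1 i)//= ffunE iT bin_small.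
apply/eqP; rewrite subr_eq0; apply/eqP.
rewrite /rooted_moment /edge_moment mulrACA -exprD addSn -big_split/=; congr (_ ^+ _.+1 * _).
  by apply: eq_bigr => i _; rewrite ffunE /bT'; case: ifP => _ /=; lia.
rewrite -p_indep.
  congr p; apply/setP => i; rewrite !inE ffunE /bT'; case: ifP => _ /=; case: eqP => //=; lia.
move=> e e' eS; rewrite inE /bT'; case: ifP => // e'T _; apply: ST => //.
move: eS; rewrite !inE => /predU1P[->//|]; rewrite ffunE; case: ifPn => // eT be.
by move/subsetP: bST => /(_ e); rewrite !inE (negPf eT) orbF; apply.
Qed.

Definition decr b e : mi := [ffun i => if i == e then inord (b i).-1 else b i].

(** Connectedness to [e0] in a form suited to counting: [b] can be emptied one unit of exponent at a
    time, each removed edge touching [e0] or an edge still present. The fuel is meant to be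
    [mdegree b]. *)
Fixpoint rooted_conn n b : bool :=
  if n is n'.+1 then
    [exists e, [&& (0 < b e)%N, rooted_conn n' (decr b e) &
       [exists e' in e0 |: supp (decr b e), touch e' e]]]
  else supp b == set0.

Lemma mdegree_decr b e : (0 < b e)%N -> mdegree b = (mdegree (decr b e)).+1.
Proof.
move=> be; rewrite /mdegree (bigD1 e)//= [in RHS](bigD1 e)//= ffunE eqxx.
rewrite inordK; last by apply: leq_ltn_trans (leq_pred _) (ltn_ord _).
rewrite -addSn prednK//; congr (_ + _)%N; apply: eq_bigr => i /negPf ie.
by rewrite ffunE ie.
Qed.

Lemma supp_decr b e : (0 < b e)%N -> supp b = e |: supp (decr b e).
Proof.
move=> be; apply/setP => i; rewrite !inE ffunE; case: eqVneq => // ->.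
by rewrite be.
Qed.

Lemma decr_inj a b e : (0 < a e)%N -> (0 < b e)%N -> decr a e = decr b e -> a = b.
Proof.
move=> ae be /ffunP ab; apply/ffunP => i; apply/val_inj => /=.
have := ab i; rewrite !ffunE; case: eqVneq => [->|_ ->//].
move/(congr1 (@nat_of_ord _)); rewrite !inordK; first lia.
- by apply: leq_ltn_trans (leq_pred _) (ltn_ord _).
- by apply: leq_ltn_trans (leq_pred _) (ltn_ord _).
Qed.

(** Take a connected [c] below [b] of maximal degree. If [c] is not [b], the edges where it falls
    short of [b] touch neither [e0] nor its support, so [cumulant_disconnected] applies. *)
Lemma cumulant_neq0_conn b : kappa b != 0 -> rooted_conn (mdegree b) b.
Proof.
move=> kb.
pose le_b a := [forall i, (a i <= b i)%N].
pose z : mi := [ffun=> ord0].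
have z_ok : rooted_conn (mdegree z) z && le_b z.
  rewrite /mdegree big1 => [|i _]; last by rewrite ffunE.
  apply/andP; split; last by apply/forallP => i; rewrite ffunE.
  by apply/eqP/setP => i; rewrite !inE ffunE.
case: (@arg_maxnP _ z (fun a => rooted_conn (mdegree a) a && le_b a) (@mdegree I D) z_ok).
move=> c /andP[conn_c /forallP cb] c_max.
have [cE|cNb] := eqVneq c b; first by rewrite -cE.
pose T := [set e | (c e < b e)%N].
(* Otherwise raising [c] by one at [e] would give a larger connected index below [b]. *)
have T_touch e : e \in T -> ~~ [exists e' in e0 |: supp c, touch e' e].
  rewrite inE => ce; apply/negP => te.
  pose c' : mi := [ffun i => if i == e then inord (c i).+1 else c i].
  have c'e : nat_of_ord (c' e) = (c e).+1.
    by rewrite ffunE eqxx inordK// ltnS (leq_trans ce)// -ltnS.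
  have decr_c' : decr c' e = c.
    apply/ffunP => i; apply/val_inj; rewrite ffunE; case: eqVneq => [->|ie] /=.
      by rewrite c'e inordK/= ?ltn_ord.
    by rewrite ffunE (negPf ie).
  have deg_c' : mdegree c' = (mdegree c).+1.
    by rewrite (@mdegree_decr _ e) ?decr_c'// c'e.
  suff : (mdegree c' <= mdegree c)%N by rewrite deg_c' ltnn.
  apply: c_max; rewrite deg_c'; apply/andP; split.
    by apply/existsP; exists e; apply/and3P; split; rewrite ?decr_c' ?c'e.
  apply/forallP => i; have [->|ie] := eqVneq i e; first by rewrite c'e.
  by rewrite ffunE (negPf ie).
case/eqP: kb; apply: (@cumulant_disconnected b (e0 |: supp c) T).
- by rewrite !inE eqxx.
- move=> e e' eS /T_touch; apply: contraNN => ee'.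
  by apply/existsP; exists e; rewrite eS.
- apply/subsetP => i; rewrite !inE => bi; have := cb i; lia.
- have [i ci] : exists i, c i != b i.
    apply/existsP; apply: contraNT cNb; rewrite negb_exists => /forallP cb'.
    by apply/eqP/ffunP => i; apply/eqP; have := cb' i; rewrite negbK.
  apply/set0Pn; exists i; rewrite !inE; have := cb i.
  by move: ci; rewrite -(inj_eq val_inj)/=; lia.
Qed.

(** The part of the sum of squared cumulants in degree [m] left after the powers of [lam] and
    [4 * D] are taken out of the squared bound. *)
Definition conn_weight m : R :=
  \sum_(b : mi | (mdegree b == m) && rooted_conn m b) p (e0 |: supp b) ^+ 2.

Lemma conn_weight0 : conn_weight 0 = p [set e0] ^+ 2.
Proof.
rewrite /conn_weight (bigD1 [ffun=> ord0])/=; last first.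
  apply/andP; split; first by rewrite /mdegree big1// => i _; rewrite ffunE.
  by apply/eqP/setP => i; rewrite !inE ffunE.
rewrite [X in e0 |: X](_ : _ = set0); last first.
  by apply/setP => i; rewrite !inE ffunE.
rewrite setU0 big1 ?addr0// => b /andP[/andP[_ /eqP b0]].
case/eqP; apply/ffunP => i; apply/val_inj; rewrite ffunE /=.
by move/setP/(_ i): b0; rewrite !inE; lia.
Qed.

Lemma card_rooted b : (#|e0 |: supp b| <= (mdegree b).+1)%N.
Proof.
apply: leq_trans (leq_card_setU _ _) _; rewrite cards1 add1n ltnS.
rewrite -sum1_card /mdegree [leqRHS](bigID (mem (supp b)))/=.
by apply: leq_trans (leq_addr _ _); apply: leq_sum => i; rewrite inE.
Qed.

(** Each connected index of degree [m.+1] arises from one of degree [m] by adding a touching edge.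
    Counting all such pairs only enlarges the sum, and the growth hypothesis bounds the choices of
    the edge. *)
Lemma conn_weightS m (Gamma : R) :
  (forall C : {set I}, (#|C| <= m.+1)%N ->
     \sum_(e | [exists e' in C, touch e' e]) p (e |: C) ^+ 2 <= Gamma * p C ^+ 2) ->
  conn_weight m.+1 <= Gamma * conn_weight m.
Proof.
move=> growth.
pose F b e := [&& (0 < b e)%N, rooted_conn m (decr b e) &
       [exists e' in e0 |: supp (decr b e), touch e' e]].
apply: (@le_trans _ _ (\sum_(b : mi | mdegree b == m.+1)
    \sum_(e | F b e) p (e0 |: supp b) ^+ 2)).
  rewrite /conn_weight big_mkcondr; apply: ler_sum => b _.
  case: ifP => [/existsP[e Fbe]|_]; last by apply: sumr_ge0 => e _; exact: sqr_ge0.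
  by rewrite (bigD1 e)//= lerDl; apply: sumr_ge0 => e' _; exact: sqr_ge0.
rewrite (exchange_big_dep xpredT)//=.
apply: (@le_trans _ _ (\sum_e \sum_(a : mi | [&& mdegree a == m, rooted_conn m a &
     [exists e' in e0 |: supp a, touch e' e]]) p (e |: (e0 |: supp a)) ^+ 2)).
  apply: ler_sum => e _.
  pose Q := [set b : mi | (mdegree b == m.+1) && F b e].
  rewrite (eq_bigl (fun b => b \in Q)); last by move=> b; rewrite inE.
  rewrite (eq_bigr (fun b => p (e |: (e0 |: supp (decr b e))) ^+ 2)); last first.
    by move=> b; rewrite inE => /andP[_ /andP[be _]]; rewrite (supp_decr be) setUCA.
  (* Once the removed edge is fixed, [b] is recovered from [decr b e], so the change of variable
     counts nothing twice. *)
  have inj : {in Q &, injective (fun b => decr b e)}.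
    move=> a b; rewrite !inE => /andP[_ /andP[ae _]] /andP[_ /andP[be _]].
    exact: decr_inj.
  rewrite -(big_imset (fun a => p (e |: (e0 |: supp a)) ^+ 2) inj)/=.
  rewrite [leLHS]big_mkcond [leRHS]big_mkcond; apply: ler_sum => a _.
  case: ifP => [/imsetP[b + ->]|_]; last by case: ifP => // _; exact: sqr_ge0.
  rewrite inE => /andP[/eqP bm /andP[be /andP[cb tb]]].
  have := mdegree_decr be; rewrite bm => -[<-].
  by rewrite eqxx cb tb.
rewrite (exchange_big_dep (fun a : mi => (mdegree a == m) && rooted_conn m a))/=; last first.
  by move=> e a _ /and3P[-> ->].
rewrite /conn_weight mulr_sumr; apply: ler_sum => a /andP[/eqP am ca].
apply: le_trans (growth _ _); last by rewrite -am card_rooted.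
by rewrite am eqxx ca.
Qed.

(** Degree [m] contributes at most [B * t ^+ m] with [t <= 1 / 10]; the geometric series then gives
    the factor 10/9. *)
Lemma sum_sqr_cumulant_le (Gamma : R) : 0 <= Gamma ->
  (forall C : {set I}, (#|C| <= D)%N ->
     \sum_(e | [exists e' in C, touch e' e]) p (e |: C) ^+ 2 <= Gamma * p C ^+ 2) ->
  10 * (lam ^+ 2 * (4 * D)%:R ^+ 2 * Gamma) <= 1 ->
  \sum_(b : mi | (mdegree b <= D)%N) kappa b ^+ 2 <=
    10 / 9 * (lam ^+ 2 * p [set e0] ^+ 2).
Proof.
move=> Gamma0 growth small; set B := lam ^+ 2 * _.
have B0 : 0 <= B by rewrite mulr_ge0 ?sqr_ge0.
pose t := lam ^+ 2 * (4 * D)%:R ^+ 2 * Gamma.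
have t0 : 0 <= t by rewrite !mulr_ge0 ?sqr_ge0.
(* Reaching degree [m] applies the growth bound only to sets of at most [m] edges, hence of at most
   [D]. *)
have weight_le m : (m <= D)%N -> conn_weight m <= Gamma ^+ m * p [set e0] ^+ 2.
  elim: m => [|m IH] mD; first by rewrite conn_weight0 mul1r.
  apply: le_trans (conn_weightS (Gamma := Gamma) _) _.
    by move=> C Cm; apply: growth; exact: leq_trans Cm mD.
  by rewrite exprS -mulrA ler_wpM2l// IH// ltnW.
have degree_le (m : 'I_D.+1) :
    \sum_(b : mi | mdegree b == m) kappa b ^+ 2 <= B * t ^+ m.
  apply: (@le_trans _ _ ((lam ^+ m.+1 * (4 * D)%:R ^+ m) ^+ 2 * conn_weight m)).
    rewrite /conn_weight big_mkcondr mulr_sumr; apply: ler_sum => b /eqP bm.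
    case: ifP => [_|/negP conn_b].
      rewrite -exprMn -real_normK ?num_real// lerXn2r ?nnegrE ?mulr_ge0 ?exprn_ge0//.
      by rewrite -bm norm_cumulant_le// bm -ltnS.
    rewrite mulr0 (_ : kappa b = 0) ?expr0n//; apply/eqP/negPn/negP => kb.
    by apply: conn_b; rewrite -bm cumulant_neq0_conn.
  apply: le_trans (ler_wpM2l (sqr_ge0 _) (weight_le _ _)) _; first by rewrite -ltnS.
  rewrite le_eqVlt; apply/orP; left; apply/eqP.
  by rewrite /B /t (exprS lam m) !exprMn; ring.
have -> : \sum_(b : mi | (mdegree b <= D)%N) kappa b ^+ 2 =
    \sum_(m < D.+1) \sum_(b : mi | mdegree b == m) kappa b ^+ 2.
  rewrite (exchange_big_dep (fun b : mi => (mdegree b <= D)%N))/=; last first.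
    by move=> m b _ /eqP ->; rewrite -ltnS.
  apply: eq_bigr => b bD; rewrite (big_pred1 (inord (mdegree b)))// => m.
  apply/eqP/eqP => [bm|->]; last by rewrite inordK.
  by apply/val_inj; rewrite /= inordK.
apply: le_trans (ler_sum _ (fun m _ => degree_le m)) _.
rewrite -mulr_sumr mulrC ler_wpM2r//.
have t10 : t <= 1 / 10 by move: small; rewrite -/t; lra.
have S0 : 0 <= \sum_(m < D.+1) t ^+ m by apply: sumr_ge0 => m _; rewrite exprn_ge0.
have := subrX1 t D.+1; have := exprn_ge0 D.+1 t0.
by move: S0; set S := \sum_(_ < _) _; nra.
Qed.

End cumulant_bounds.

(** * The block prior *)

Section block_prior.
Variables (n1 n2 k' : nat).
Local Notation k := k'.+2.
Local Notation edge := ('I_n1 * 'I_n2)%type.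
Local Notation labeling := 'rV['I_k]_(n1 + n2).
Implicit Types (S T : {set edge}) (e : edge) (g : labeling).

Definition same_label g e : bool := g 0 (lshift n2 e.1) == g 0 (rshift n1 e.2).
Definition consistent S : {set labeling} := [set g | [forall e in S, same_label g e]].
Definition touch : rel edge := [rel e f | (e.1 == f.1) || (e.2 == f.2)].

Lemma consistentP S g : reflect (forall e, e \in S -> same_label g e) (g \in consistent S).
Proof. by rewrite inE; exact: forall_inP. Qed.

(** Equality of two labels survives coordinatewise addition in Z/k. The subgroup structure gives
    access to the product formula for cardinals. *)
Lemma group_set_consistent S : group_set (consistent S).
Proof.
apply/group_setP; split.
  by apply/consistentP => e _; rewrite /same_label FinRing.zmod1gE !mxE.
move=> g h /consistentP gS /consistentP hS; apply/consistentP => e eS.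
by rewrite /same_label FinRing.zmodMgE !mxE (eqP (gS e eS)) (eqP (hS e eS)).
Qed.
Canonical consistent_group S := Group (group_set_consistent S).

Lemma consistentU S T : consistent (S :|: T) = consistent S :&: consistent T.
Proof.
apply/setP => g; rewrite in_setI; apply/consistentP/andP => [ST|[/consistentP gS /consistentP gT] e].
  by split; apply/consistentP => e eS; apply: ST; rewrite inE eS ?orbT.
by rewrite inE => /orP[/gS|/gT].
Qed.

Lemma consistent0 : consistent set0 = setT.
Proof. by apply/setP => g; rewrite in_setT; apply/consistentP => e; rewrite inE. Qed.

(** For subgroups [A] and [B], [|A| |B| = |AB| |A :&: B|], and the product set has at most as many
    elements as the whole group. *)
Lemma card_consistent_supermul S T :
  (#|consistent S| * #|consistent T| <= #|{: labeling}| * #|consistent (S :|: T)|)%N.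
Proof. by rewrite consistentU mul_cardG leq_mul2r max_card orbT. Qed.

Lemma card_consistent_indep S T :
  (forall e f, e \in S -> f \in T -> ~~ touch e f) ->
  (#|consistent S| * #|consistent T| = #|{: labeling}| * #|consistent (S :|: T)|)%N.
Proof.
move=> ST; rewrite consistentU mul_cardG; congr (_ * _)%N.
rewrite -cardsT; congr #|pred_of_set _|; apply/setP => g; rewrite in_setT; apply/mulsgP.
(* [g] splits into its restriction to the vertices of [S], which satisfies [T]
   trivially, and the complementary restriction, which satisfies [S] trivially *)
pose inS (x : 'I_(n1 + n2)) :=
  [exists e in S, (lshift n2 e.1 == x) || (rshift n1 e.2 == x)].
pose gS : labeling := \row_x (if inS x then g 0 x else 0).
exists (g - gS) gS.
- apply/consistentP => e eS; rewrite /same_label !mxE.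
  have -> : inS (lshift n2 e.1) by apply/existsP; exists e; rewrite eS eqxx.
  have -> : inS (rshift n1 e.2) by apply/existsP; exists e; rewrite eS eqxx orbT.
  by rewrite !subrr.
- apply/consistentP => f fT; rewrite /same_label !mxE.
  have -> : inS (lshift n2 f.1) = false.
    apply/negbTE/negP => /existsP[e /andP[eS]].
    rewrite (inj_eq (@lshift_inj _ _)) eq_rlshift orbF => ef.
    by have := ST e f eS fT; rewrite /touch/= ef.
  have -> // : inS (rshift n1 f.2) = false.
  apply/negbTE/negP => /existsP[e /andP[eS]].
  rewrite (inj_eq (@rshift_inj _ _)) eq_lrshift/= => ef.
  by have := ST e f eS fT; rewrite /touch/= ef orbT.
- by rewrite FinRing.zmodMgE subrK.
Qed.

(** The label of a vertex [x] not met by [S] is free under [S], and the new edge determines it. In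
    group terms, the labelings supported at [x] form a complement, of order [k], of the smaller
    subgroup in the larger one. *)
Lemma card_consistent_leaf S e (x : 'I_(n1 + n2)) :
  (x == lshift n2 e.1) || (x == rshift n1 e.2) ->
  (forall f, f \in S -> (lshift n2 f.1 != x) && (rshift n1 f.2 != x)) ->
  (#|consistent (e |: S)| * k = #|consistent S|)%N.
Proof.
move=> xe xS; pose delta (a : 'I_k) : labeling := \row_y (if y == x then a else 0).
have delta_inj : injective delta.
  by move=> a b /rowP/(_ x); rewrite !mxE eqxx.
have K_set : group_set [set delta a | a : 'I_k].
  apply/group_setP; split.
    apply/imsetP; exists 0 => //; apply/rowP => y; rewrite FinRing.zmod1gE !mxE.
    by case: ifP.
  move=> _ _ /imsetP[a _ ->] /imsetP[b _ ->]; apply/imsetP; exists (a + b) => //.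
  by apply/rowP => y; rewrite FinRing.zmodMgE !mxE; case: ifP => // _; rewrite addr0.
pose K := Group K_set.
have cardK : #|K| = k by rewrite card_imset// card_ord.
have delta_consistent a : delta a \in consistent S.
  apply/consistentP => f /xS /andP[/negPf f1 /negPf f2].
  by rewrite /same_label !mxE f1 f2.
have neq_lr : (lshift n2 e.1 == rshift n1 e.2) = false by rewrite eq_lrshift.
have KI : consistent (e |: S) :&: K = 1%g.
  apply/setP => g; rewrite in_setI in_set1; apply/andP/eqP => [[/consistentP gS /imsetP[a _ gE]]|->].
    have := gS e; rewrite in_setU1 eqxx => /(_ isT).
    rewrite gE /same_label !mxE FinRing.zmod1gE; case/orP: xe => /eqP xE.
      rewrite -xE eqxx [_ == x]eq_sym xE neq_lr => /eqP ->.
      by apply/rowP => y; rewrite !mxE; case: ifP.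
    rewrite -xE eqxx xE neq_lr eq_sym => /eqP ->.
    by apply/rowP => y; rewrite !mxE; case: ifP.
  split; first exact: (group1 (consistent_group _)).
  exact: (group1 K).
have KM : (consistent (e |: S) * K)%g = consistent S.
  apply/setP => g; apply/mulsgP/consistentP => [[h _ /consistentP hS /imsetP[a _ ->] ->] f fS|gS].
    have := consistentP _ _ (delta_consistent a) f fS.
    rewrite /same_label FinRing.zmodMgE !mxE => /eqP ->.
    by have := hS f; rewrite in_setU1 fS orbT => /(_ isT) /eqP ->.
  (* Subtracting [delta a'] makes the ends of [e] agree; the sign depends on whether [x] is its row
     end or its column end. *)
  pose a := g 0 (lshift n2 e.1) - g 0 (rshift n1 e.2).
  pose a' := if x == lshift n2 e.1 then a else - a.
  exists (g - delta a') (delta a'); last by rewrite FinRing.zmodMgE subrK.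
    apply/consistentP => f; rewrite in_setU1 => /predU1P[->|fS].
      rewrite /same_label !mxE /a' /a; case/orP: xe => /eqP xE.
        by rewrite -xE !eqxx [_ == x]eq_sym xE neq_lr subr0 opprB addrCA subrr addr0.
      rewrite [x == _]eq_sym [rshift _ _ == x]eq_sym xE neq_lr eqxx subr0 opprK.
      by rewrite addrC subrK.
    have := consistentP _ _ (delta_consistent a') f fS; rewrite /same_label !mxE => /eqP ->.
    by rewrite (eqP (gS f fS)).
  by apply/imsetP; exists a'.
by have := mul_cardG (consistent_group (e |: S)) K; rewrite KI cards1 muln1 KM cardK.
Qed.

Variable R : realFieldType.

Definition consistent_prob S : R := #|consistent S|%:R / #|{: labeling}|%:R.

Let N_gt0 : 0 < #|{: labeling}|%:R :> R.
Proof. by rewrite ltr0n; apply/card_gt0P; exists 0. Qed.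

Lemma consistent_prob_ge0 S : 0 <= consistent_prob S.
Proof. by rewrite divr_ge0 ?ler0n. Qed.

Lemma consistent_prob0 : consistent_prob set0 = 1.
Proof. by rewrite /consistent_prob consistent0 cardsT divff// gt_eqF. Qed.

Lemma consistent_prob_supermul S T :
  consistent_prob S * consistent_prob T <= consistent_prob (S :|: T).
Proof.
rewrite /consistent_prob mulrACA -invfM ler_pdivrMr ?mulr_gt0// mulrA divfK ?gt_eqF//.
by rewrite -!natrM ler_nat mulnC [leqRHS]mulnC mulnC card_consistent_supermul.
Qed.

Lemma consistent_prob_indep S T :
  (forall e f, e \in S -> f \in T -> ~~ touch e f) ->
  consistent_prob (S :|: T) = consistent_prob S * consistent_prob T.
Proof.
move=> ST; rewrite /consistent_prob mulrACA -natrM (card_consistent_indep ST) natrM.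
by field; rewrite gt_eqF.
Qed.

Lemma consistent_prob_leaf S e (x : 'I_(n1 + n2)) :
  (x == lshift n2 e.1) || (x == rshift n1 e.2) ->
  (forall f, f \in S -> (lshift n2 f.1 != x) && (rshift n1 f.2 != x)) ->
  consistent_prob (e |: S) = consistent_prob S / k%:R.
Proof.
move=> xe xS; rewrite /consistent_prob -(card_consistent_leaf xe xS) natrM.
by rewrite [RHS]mulrAC mulfK// pnatr_eq0.
Qed.

Lemma consistent_prob1 e : consistent_prob [set e] = k%:R^-1.
Proof.
rewrite -[[set e]]setU0 (@consistent_prob_leaf _ _ (lshift n2 e.1)) ?eqxx//.
  by rewrite consistent_prob0 mul1r.
by move=> f; rewrite inE.
Qed.

Lemma consistent_prob_mono S T : S \subset T -> consistent_prob T <= consistent_prob S.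
Proof.
move=> ST; rewrite /consistent_prob ler_wpM2r ?invr_ge0 ?ler0n// ler_nat subset_leq_card//.
by apply/subsetP => g /consistentP gT; apply/consistentP => e /(subsetP ST)/gT.
Qed.

(** At most [D ^ 2] edges have both ends among the vertices of [C], and adding one cannot raise the
    probability. At most [D * (n1 + n2)] have exactly one new end, and each such edge divides the
    probability by [k]. *)
Lemma consistent_prob_growth D (C : {set edge}) : (#|C| <= D)%N ->
  \sum_(e | [exists e' in C, touch e' e]) consistent_prob (e |: C) ^+ 2 <=
  (D%:R ^+ 2 + D%:R * (n1 + n2)%:R / k%:R ^+ 2) * consistent_prob C ^+ 2.
Proof.
move=> CD; pose V1 := [set e.1 | e in C]; pose V2 := [set e.2 | e in C].
have V1D : (#|V1| <= D)%N by apply: leq_trans CD; exact: leq_imset_card.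
have V2D : (#|V2| <= D)%N by apply: leq_trans CD; exact: leq_imset_card.
have in1 e : e.1 \notin V1 -> consistent_prob (e |: C) = consistent_prob C / k%:R.
  move=> e1; apply: (@consistent_prob_leaf _ _ (lshift n2 e.1)); rewrite ?eqxx// => f fC.
  rewrite eq_rlshift andbT (inj_eq (@lshift_inj _ _)); apply: contraNneq e1 => <-.
  exact: imset_f.
have in2 e : e.2 \notin V2 -> consistent_prob (e |: C) = consistent_prob C / k%:R.
  move=> e2; apply: (@consistent_prob_leaf _ _ (rshift n1 e.2)); rewrite ?eqxx ?orbT// => f fC.
  rewrite eq_lrshift/= (inj_eq (@rshift_inj _ _)); apply: contraNneq e2 => <-.
  exact: imset_f.
pose c1 e : R := (e.1 \in V1)%:R; pose c2 e : R := (e.2 \in V2)%:R.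
have k2 : 0 <= k%:R ^- 2 :> R by rewrite invr_ge0 sqr_ge0.
have p2 : 0 <= consistent_prob C ^+ 2 by exact: sqr_ge0.
(* This weight dominates both cases: the product of indicators covers edges without a new vertex,
   the sum covers those with one. *)
apply: (@le_trans _ _ (\sum_e (c1 e * c2 e + (c1 e + c2 e) * k%:R ^- 2) * consistent_prob C ^+ 2)).
  rewrite big_mkcond; apply: ler_sum => e _; case: ifP => [/existsP[f /andP[fC fe]]|_]; last first.
    by rewrite mulr_ge0// addr_ge0 ?mulr_ge0 ?addr_ge0 ?ler0n.
  have : (e.1 \in V1) || (e.2 \in V2).
    by case/orP: fe => /eqP <-; apply/orP; [left|right]; exact: imset_f.
  rewrite /c1 /c2; have [e1|e1] := boolP (e.1 \in V1); have [e2|e2] := boolP (e.2 \in V2) => //= _.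
  - rewrite !mul1r mulrDl mul1r -[leLHS]addr0 lerD//; last by rewrite mulr_ge0// mulr_ge0// addr_ge0.
    by rewrite lerXn2r ?nnegrE ?consistent_prob_ge0// consistent_prob_mono// subsetUr.
  - by rewrite (in2 _ e2) mulr0 add0r addr0 mul1r exprMn exprVn mulrC.
  - by rewrite (in1 _ e1) mul0r !add0r mul1r exprMn exprVn mulrC.
rewrite -mulr_suml ler_wpM2r// big_split/= -mulr_suml.
have sum1 : \sum_(i < n1) (i \in V1)%:R = #|V1|%:R :> R.
  by rewrite -sum1_card natr_sum [RHS]big_mkcond; apply: eq_bigr => ? _; case: ifP.
have sum2 : \sum_(j < n2) (j \in V2)%:R = #|V2|%:R :> R.
  by rewrite -sum1_card natr_sum [RHS]big_mkcond; apply: eq_bigr => ? _; case: ifP.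
have sum12 : \sum_e c1 e * c2 e = #|V1|%:R * #|V2|%:R.
  rewrite -(pair_bigA _ (fun i j => (i \in V1)%:R * (j \in V2)%:R))/=.
  by under eq_bigr do rewrite -mulr_sumr; rewrite -mulr_suml sum1 sum2.
have sumc1 : \sum_e c1 e = #|V1|%:R * n2%:R.
  rewrite -(pair_bigA _ (fun i j => (i \in V1)%:R))/=.
  by rewrite -sum1 mulr_suml; apply: eq_bigr => i _; rewrite sumr_const card_ord mulr_natr.
have sumc2 : \sum_e c2 e = n1%:R * #|V2|%:R.
  rewrite -(pair_bigA _ (fun i j => (j \in V2)%:R))/=.
  by under eq_bigr do rewrite sum2; rewrite sumr_const card_ord mulr_natl.
rewrite sum12 big_split/= sumc1 sumc2; apply: lerD.
  by rewrite expr2 ler_pM ?ler0n// ler_nat.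
rewrite ler_wpM2r// -!natrM -natrD ler_nat mulnDr addnC leq_add//.
  by rewrite mulnC leq_mul2r V2D orbT.
by rewrite leq_mul2r V1D orbT.
Qed.

End block_prior.

(** * Moments and cumulants of the block prior *)

Section block_cumulants.
Variables (R : realFieldType) (n1 n2 k' D : nat) (lam : R) (e0 : 'I_n1 * 'I_n2).
Local Notation k := k'.+2.
Local Notation labeling := 'rV['I_k]_(n1 + n2).

Definition block_entry (g : labeling) (e : 'I_n1 * 'I_n2) : R :=
  lam * (same_label g e)%:R.

Lemma prod_block_entry g (f : 'I_n1 * 'I_n2 -> nat) :
  \prod_e block_entry g e ^+ f e =
  lam ^+ (\sum_e f e) * (g \in consistent k' (esupp f))%:R.
Proof.
under eq_bigr do rewrite exprMn.
rewrite big_split/= prodrXr; congr (_ * _).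
have [/consistentP gS|gS] := boolP (g \in _).
  rewrite big1// => e _; have [->//|fe] := posnP (f e).
  by rewrite gS ?expr1n// inE.
have [e eS ge] : exists2 e, e \in esupp f & ~~ same_label g e.
  by apply/exists_inP; move: gS; rewrite inE negb_forall_in.
rewrite (bigD1 e)//= (negPf ge) expr0n; move: eS; rewrite inE.
by case: (f e) => // ? _; rewrite mul0r.
Qed.

Lemma sum_same_label (S : {set 'I_n1 * 'I_n2}) :
  #|{: labeling}|%:R^-1 * \sum_(g : labeling) (g \in consistent k' S)%:R = consistent_prob k' R S.
Proof.
by rewrite /consistent_prob mulrC -natr_sum -big_mkcond/= sum1_card.
Qed.

Lemma edge_momentE (f : 'I_n1 * 'I_n2 -> nat) :
  #|{: labeling}|%:R^-1 * \sum_g 1 * \prod_e block_entry g e ^+ f e =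
  edge_moment lam (@consistent_prob n1 n2 k' R) f.
Proof.
under eq_bigr do rewrite mul1r prod_block_entry.
by rewrite -mulr_sumr mulrCA sum_same_label.
Qed.

Lemma rooted_momentE (f : 'I_n1 * 'I_n2 -> nat) :
  #|{: labeling}|%:R^-1 * \sum_g block_entry g e0 * \prod_e block_entry g e ^+ f e =
  rooted_moment lam e0 (@consistent_prob n1 n2 k' R) f.
Proof.
rewrite /rooted_moment -sum_same_label mulrCA; congr (_ * _).
rewrite mulr_sumr; apply: eq_bigr => g _.
rewrite prod_block_entry /block_entry mulrACA -exprS; congr (_ * _).
rewrite -natrM mulnb consistentU in_setI; congr (_ && _)%:R.
apply/idP/consistentP => [ge e|]; first by rewrite inE => /eqP ->.
by apply; rewrite inE.
Qed.

Lemma sum_sqr_block_entry :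
  \sum_g block_entry g e0 ^+ 2 = #|{: labeling}|%:R * (lam ^+ 2 / k%:R).
Proof.
have N0 : #|{: labeling}|%:R != 0 :> R.
  by rewrite pnatr_eq0 -lt0n; apply/card_gt0P; exists 0.
rewrite -(consistent_prob1 k' R e0) -sum_same_label mulrCA mulVKf//.
rewrite mulr_sumr; apply: eq_bigr => g _; rewrite /block_entry exprMn; congr (_ * _).
have -> : (g \in consistent k' [set e0]) = same_label g e0.
  by apply/consistentP/idP => [|ge e]; [apply|]; rewrite inE// => /eqP ->.
by case: same_label; rewrite ?expr1n ?expr0n.
Qed.

(** The constant 480 is [3 * 160], where [160 = 10 * 4 ^ 2] comes from the smallness condition of
    the geometric series. Edges without a new vertex use 1/3 of the allowance; the others use 2/3,
    because [n1 + n2 <= 2 n]. *)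
Lemma sum_sqr_block_cumulant_le n : (n1 <= n)%N -> (n2 <= n)%N ->
  480 * (lam ^+ 2 * D%:R ^+ 4) <= 1 ->
  480 * (lam ^+ 2 * D%:R ^+ 4) * n%:R <= k%:R ^+ 2 -> 0 <= lam ->
  \sum_(b : {ffun 'I_n1 * 'I_n2 -> 'I_D.+1} | (mdegree b <= D)%N)
    @cumulant _ D R (rooted_moment lam e0 (@consistent_prob n1 n2 k' R))
      (edge_moment lam (@consistent_prob n1 n2 k' R)) b ^+ 2 / (mfact b)%:R <=
  10 / 9 * (lam ^+ 2 / k%:R ^+ 2).
Proof.
move=> n1n n2n lam1 lamn lam0.
set kap := cumulant _ _.
apply: (@le_trans _ _ (\sum_(b : {ffun 'I_n1 * 'I_n2 -> 'I_D.+1} | (mdegree b <= D)%N)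
    kap b ^+ 2)).
  apply: ler_sum => b _; rewrite ler_piMr ?sqr_ge0// invf_le1 ?ltr0n ?mfact_gt0//.
  by rewrite ler1n mfact_gt0.
have := @sum_sqr_cumulant_le R _ D lam e0 (@consistent_prob n1 n2 k' R) (@touch n1 n2) lam0
  (@consistent_prob_ge0 _ _ _ _) (@consistent_prob0 _ _ _ _) (@consistent_prob_supermul _ _ _ _)
  (@consistent_prob_indep _ _ _ _) (D%:R ^+ 2 + D%:R * (n1 + n2)%:R / k%:R ^+ 2).
rewrite consistent_prob1 exprVn; apply.
- by rewrite addr_ge0 ?sqr_ge0 ?mulr_ge0 ?ler0n ?invr_ge0 ?sqr_ge0.
- exact: consistent_prob_growth.
have k0 : 0 < k%:R ^+ 2 :> R by rewrite exprn_gt0 ?ltr0n.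
have [D0|D0] := posnP D; first by rewrite D0 muln0 expr0n mulr0 mul0r mulr0 ler01.
have D1 : 1 <= D%:R :> R by rewrite ler1n.
have n12 : (n1 + n2)%:R <= 2 * n%:R :> R by rewrite -natrM ler_nat; lia.
rewrite natrM; set d := D%:R in D1 lam1 lamn *; set N : R := (_ + _)%:R in n12 *.
set K := _%:R ^+ 2 in k0 lamn *; set l := lam ^+ 2.
have l0 : 0 <= l by exact: sqr_ge0.
rewrite [leLHS](_ : _ = 160 * (l * d ^+ 4) + 160 * (l * d ^+ 3 * N) / K); last first.
  by field; rewrite gt_eqF.
have : 160 * (l * d ^+ 3 * N) / K <= 2 / 3.
  rewrite ler_pdivrMr//; apply: (@le_trans _ _ (160 * (l * d ^+ 4 * (2 * n%:R)))).
    rewrite ler_wpM2l//; apply: ler_pM => //.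
    - by rewrite mulr_ge0// exprn_ge0// (le_trans ler01).
    - by rewrite ler_wpM2l// ler_weXn2l.
  by move: lamn; rewrite -/l; lra.
by move: lam1; rewrite -/l; lra.
Qed.

End block_cumulants.

Require Import Defs.
From mathcomp Require Import all_classical all_reals all_analysis.
From mathcomp Require Import measurable_realfun.
From mathcomp Require mpoly.
Import (coercions, canonicals) mpoly.
Import Order.TTheory GRing.Theory Num.Theory.
Import numFieldNormedType.Exports.
Local Open Scope classical_set_scope.
Local Open Scope ring_scope.

(** * Gaussian moments *)

Section density.
Context d1 d2 (X : measurableType d1) (Y : measurableType d2) (R : realType).
Import HBNNSimple.

(** Monotone convergence along simple functions: the right side sees [mu], [phi] and [h] only
    through integrals of indicators. *)
Lemma ge0_integral_comp_mul (mu : {measure set X -> \bar R}) (phi : X -> Y)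
    (h : X -> R) (f : Y -> R) (mf : measurable_fun [set: Y] (fun y => (f y)%:E)) :
  measurable_fun setT phi -> measurable_fun setT h -> (forall x, 0 <= h x) ->
  (forall y, 0 <= f y) ->
  (\int[mu]_x (f (phi x) * h x)%:E =
   limn (fun n => \sum_(r \in range (nnsfun_approx measurableT mf n))
     r%:E * \int[mu]_x
       (\1_(nnsfun_approx measurableT mf n @^-1` [set r]) (phi x) * h x)%:E))%E.
Proof.
move=> mphi mh h0 f0; pose f_ := nnsfun_approx measurableT mf.
have m1 n : measurable_fun setT (fun x => f_ n (phi x) * h x).
  by apply: measurable_funM => //; apply: measurableT_comp.
transitivity (limn (fun n => \int[mu]_x (f_ n (phi x) * h x)%:E)%E).
  rewrite -monotone_convergence//.
  - apply: eq_integral => x _; apply/esym/cvg_lim => //.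
    rewrite EFinM; under eq_fun do rewrite EFinM.
    apply: cvgeZr => //.
    apply: (@cvg_nnsfun_approx _ _ _ _ measurableT (fun y => (f y)%:E) mf) => //.
    by move=> y _; rewrite lee_fin.
  - by move=> n; apply/measurable_EFinP.
  - by move=> n x _; rewrite lee_fin mulr_ge0.
  - move=> x _ m n mn; rewrite lee_fin ler_wpM2r//.
    exact/lefP/nd_nnsfun_approx.
congr (limn _); apply/funext => n.
have mI r : measurable_fun setT
    (fun x => \1_(f_ n @^-1` [set r]) (phi x) * h x).
  apply: measurable_funM => //; apply: (measurableT_comp _ mphi).
  exact: measurable_indic.
transitivity (\sum_(r \in range (f_ n)) \int[mu]_x
     (r * (\1_(f_ n @^-1` [set r]) (phi x) * h x))%:E)%E.
  rewrite -ge0_integral_fsum//.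
  - apply: eq_integral => x _; rewrite fsumEFin//; congr EFin.
    rewrite (fimfunE (f_ n) (phi x)) mulr_fsuml.
    by apply: eq_fsbigr => r _; rewrite mulrA.
  - by move=> r; apply/measurable_EFinP/measurable_funM.
  - move=> r x _; rewrite lee_fin mulrA mulr_ge0//.
    by have := nnfun_muleindic_ge0 (f_ n) r (phi x); rewrite lee_fin.
apply: eq_fsbigr => r; rewrite inE => -[y _ <-].
under eq_integral do rewrite EFinM.
rewrite ge0_integralZl//.
- exact/measurable_EFinP.
- by move=> x _; rewrite lee_fin mulr_ge0.
- by rewrite lee_fin.
Qed.


End density.

(** * Equality of integrals deduced from equality on indicators *)

Section transfer.
Import HBNNSimple.
Context d1 d2 d (X1 : measurableType d1) (X2 : measurableType d2)
  (Y : measurableType d) (R : realType).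
Variables (mu1 : {measure set X1 -> \bar R}) (mu2 : {measure set X2 -> \bar R}).
Variables (phi1 : X1 -> Y) (phi2 : X2 -> Y) (h1 : X1 -> R) (h2 : X2 -> R).
Hypotheses (mphi1 : measurable_fun setT phi1) (mphi2 : measurable_fun setT phi2).
Hypotheses (mh1 : measurable_fun setT h1) (mh2 : measurable_fun setT h2).
Hypotheses (h10 : forall x, 0 <= h1 x) (h20 : forall x, 0 <= h2 x).
Hypothesis eq_indic : forall A, measurable A ->
  (\int[mu1]_x (\1_A (phi1 x) * h1 x)%:E =
   \int[mu2]_x (\1_A (phi2 x) * h2 x)%:E)%E.

Lemma ge0_integral_transfer (f : Y -> R) : measurable_fun setT f ->
  (forall y, 0 <= f y) ->
  (\int[mu1]_x (f (phi1 x) * h1 x)%:E = \int[mu2]_x (f (phi2 x) * h2 x)%:E)%E.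
Proof.
move=> mf f0.
have mf' : measurable_fun [set: Y] (fun y => (f y)%:E) by apply/measurable_EFinP.
rewrite !(ge0_integral_comp_mul _ mf')//.
congr (limn _); apply/funext => n; apply: eq_fsbigr => r _.
by rewrite eq_indic.
Qed.

(** Serves twice: to replace the law of a noise entry by the Gaussian density, and to separate one
    factor of a product of independent variables. *)
Lemma integral_transfer (f : Y -> R) : measurable_fun setT f ->
  mu2.-integrable setT (fun x => (f (phi2 x) * h2 x)%:E) ->
  mu1.-integrable setT (fun x => (f (phi1 x) * h1 x)%:E) /\
  (\int[mu1]_x (f (phi1 x) * h1 x)%:E = \int[mu2]_x (f (phi2 x) * h2 x)%:E)%E.
Proof.
move=> mf /integrableP[mf2 if2]; split.
  apply/integrableP; split.
    apply/measurable_EFinP/measurable_funM => //; exact: measurableT_comp.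
  move: if2; under eq_integral do rewrite abse_EFin normrM (ger0_norm (h20 _)).
  under [X in _ -> (X < _)%E]eq_integral do
    rewrite abse_EFin normrM (ger0_norm (h10 _)).
  rewrite (ge0_integral_transfer (f := fun y => `|f y|))//.
  exact: measurableT_comp.
(* The weight is nonnegative, so it can be pulled out of the positive and negative parts. *)
have pos (Z : Type) (phi : Z -> Y) (h : Z -> R) : (forall x, 0 <= h x) ->
    (fun x => (f (phi x) * h x)%:E)^\+%E =
    (fun x => (Num.max (f (phi x)) 0 * h x)%:E).
  move=> h0; apply/funext => x; rewrite funeposE -EFin_max; congr EFin.
  by rewrite maxr_pMl// mul0r.
have neg (Z : Type) (phi : Z -> Y) (h : Z -> R) : (forall x, 0 <= h x) ->
    (fun x => (f (phi x) * h x)%:E)^\-%E =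
    (fun x => (Num.max (- f (phi x)) 0 * h x)%:E).
  move=> h0; apply/funext => x; rewrite funenegE -EFinN -EFin_max; congr EFin.
  by rewrite maxr_pMl// mul0r mulNr.
rewrite [LHS]integralE [RHS]integralE !pos// !neg//.
rewrite (ge0_integral_transfer (f := fun y => Num.max (f y) 0))//; last 2 first.
- exact: measurable_maxr.
- by move=> y; rewrite le_max lexx orbT.
rewrite (ge0_integral_transfer (f := fun y => Num.max (- f y) 0))//.
- by apply: measurable_maxr => //; exact: measurableT_comp.
- by move=> y; rewrite le_max lexx orbT.
Qed.

End transfer.

Section integral_derivative.
Context {R : realType}.
Local Notation mu := (@lebesgue_measure R).

(** The integral over [[-n, n]] is [F n - F (-n)], which tends to 0; dominated convergence
    identifies its limit with the integral over the line. *)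
Lemma integral_derivative0 (F f : R -> R) :
  (forall x : R, is_derive x 1 F (f x)) -> continuous f ->
  mu.-integrable setT (EFin \o f) ->
  F n%:R @[n --> \oo] --> 0 -> F (- n%:R) @[n --> \oo] --> 0 ->
  (\int[mu]_x (f x)%:E = 0)%E.
Proof.
move=> dF cf intf Fy FNy.
have cF : continuous F.
  by move=> x; apply/differentiable_continuous/derivable1_diffP; exact: ex_derive.
pose f_ (n : nat) := (EFin \o f) \_ (`[- n%:R, n%:R] : set R).
have [|//||||_ _ ] := @dominated_convergence _ _ R mu setT measurableT f_
  (EFin \o f) (fun x => `|(f x)%:E|)%E.
- move=> n; apply/(measurable_restrictT _ _).1 => //.
  by apply: measurable_funTS; case/integrableP: intf.
- by case/integrableP: intf.
- apply: aeW => /= x _; apply: cvg_near_cst.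
  near=> n; rewrite /f_ patchE mem_set//= in_itv/= -ler_norml.
  near: n; exact: nbhs_infty_ger.
- exact: integrable_abse.
- apply: aeW => /= x n _; rewrite /f_ patchE; case: ifP => // _.
  by rewrite abse0.
have f_E : \forall n \near \oo, (F n%:R - F (- n%:R))%:E = (\int[mu]_x f_ n x)%E.
  exists 1%N => // n /= n1; rewrite -integral_mkcond (continuous_FTC2 _ (F := F))//=.
  - by rewrite gtrN// ltr0n.
  - exact: continuous_subspaceT.
  - split.
    + by move=> x _; exact: ex_derive.
    + by apply: cvg_at_right_filter; exact: cF.
    + by apply: cvg_at_left_filter; exact: cF.
  - by move=> x _; rewrite derive1E; exact: derive_val.
move=> cvgI.
have cvg0 : (F n%:R - F (- n%:R))%:E @[n --> \oo] --> 0%:E.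
  by apply: cvg_EFin; [exact: nearW|rewrite -[X in _ --> X]subr0; exact: cvgB].
rewrite -(cvg_lim (@ereal_hausdorff R) cvgI).
apply/cvg_lim => //; apply: cvg_trans cvg0; exact: near_eq_cvg.
Unshelve. all: by end_near. Qed.

End integral_derivative.

(** * Moments of the standard normal density *)

Section normal_moments.
Context {R : realType}.
Local Notation phi := (normal_pdf (0 : R) 1).
Local Notation mu := (@lebesgue_measure R).

Let pdfE (m x : R) :
  normal_pdf m 1 x = normal_peak 1 * expR (- (x - m) ^+ 2 / 2).
Proof. by rewrite normal_pdfE ?oner_eq0//= /normal_fun expr1n. Qed.

(** From [|x|^n / n! <= exp |x|], and completing the square turns [exp x] or [exp (-x)] times the
    density into a multiple of a shifted normal density. Both integrability and decay at infinity
    follow from it. *)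
Lemma normr_Xn_normal_pdf_le n (x : R) : `|x ^+ n * phi x| <=
  n`!%:R * expR (2^-1) * (normal_pdf 1 1 x + normal_pdf (-1) 1 x).
Proof.
have pk : 0 <= normal_peak (1 : R) := normal_peak_ge0 _.
have e (y : R) : y = x \/ y = - x -> expR y * expR (- (x - 0) ^+ 2 / 2) =
    expR (2^-1) * expR (- (x - (if y == x then 1 else -1)) ^+ 2 / 2).
  move=> yx; rewrite -!expRD; congr expR; case: yx => ->; rewrite ?eqxx; first by field.
  case: eqP => [xE|_]; last by field.
  have -> : x = 0 by lra.
  by field.
have le_exp : `|x| ^+ n / n`!%:R <= expR `|x|.
  case: n => [|n]; first by rewrite expr0 divr1 -expR0 ler_expR.
  by apply: le_trans (expR_ge1Dxn n (normr_ge0 x)); rewrite lerDr ler01.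
have : expR `|x| * phi x <= expR 2^-1 * (normal_pdf 1 1 x + normal_pdf (-1) 1 x).
  have e1 : expR x * phi x = expR (2^-1) * normal_pdf 1 1 x.
    by rewrite !pdfE mulrCA e ?eqxx; [rewrite mulrCA|left].
  have e2 : expR (- x) * phi x = expR (2^-1) * normal_pdf (-1) 1 x.
    rewrite !pdfE mulrCA e; last by right.
    case: eqP => [xE|_]; last by rewrite mulrCA.
    have -> : x = 0 by lra.
    by rewrite mulrCA; congr (_ * (_ * expR _)); field.
  have p1 := normal_pdf_ge0 1 1 x; have p2 := normal_pdf_ge0 (-1) 1 x.
  have ge0 := expR_ge0 (2^-1 : R).
  rewrite mulrDr -e1 -e2; have [x0|x0] := leP 0 x.
    by rewrite ger0_norm// lerDl e2 mulr_ge0.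
  by rewrite ltr0_norm// lerDr e1 mulr_ge0.
move=> le_B.
have n0 : 0 < n`!%:R :> R by rewrite ltr0n fact_gt0.
rewrite -mulrA normrM normrX (ger0_norm (normal_pdf_ge0 _ _ _)).
rewrite -ler_pdivrMl//; apply: le_trans le_B.
by rewrite mulrA ler_wpM2r ?normal_pdf_ge0// mulrC.
Qed.

Lemma integrable_Xn_normal_pdf n :
  mu.-integrable setT (fun x => (x ^+ n * phi x)%:E).
Proof.
apply: (@le_integrable _ _ _ mu setT _ _ (fun x =>
   (n`!%:R * expR (2^-1))%:E *
    ((normal_pdf 1 1 x)%:E + (normal_pdf (-1) 1 x)%:E))%E) => //.
- apply/measurable_EFinP/measurable_funM; first exact: measurable_funX.
  exact: measurable_normal_pdf.
- move=> x _; rewrite -EFinD -EFinM !abse_EFin lee_fin.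
  by apply: le_trans (normr_Xn_normal_pdf_le _ _) _; rewrite ler_norm.
- apply: integrableZl => //; apply: integrableD => //; exact: integrable_normal_pdf.
Qed.

Let is_derive_phi (x : R) : is_derive x 1 phi (- x * phi x).
Proof.
rewrite (_ : normal_pdf 0 1 = fun y : R => normal_peak 1 * expR (- y ^+ 2 / 2)); last first.
  by apply/funext => y; rewrite pdfE subr0.
apply: is_derive_eq; rewrite /GRing.scale/= /GRing.scale/=.
by field.
Qed.

Let cvg_Xn_phi n (s : nat -> R) : (forall k, `|s k| = k%:R) ->
  s k ^+ n * phi (s k) @[k --> \oo] --> 0.
Proof.
(* The bound for exponent [n.+1] leaves one spare factor [|s k| = k], hence decay at rate
   [C / k]. *)
move=> sE; pose C : R := n.+1`!%:R * expR 2^-1 * (normal_peak 1 + normal_peak 1).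
apply: norm_cvg0.
apply: (@squeeze_cvgr _ _ _ _ (fun=> 0) (fun k => C * k%:R^-1)).
- exists 1%N => // k /= k1; rewrite normr_ge0/=.
  rewrite ler_pdivlMr ?ltr0n// -(sE k) -normrM mulrAC -exprSr.
  apply: le_trans (normr_Xn_normal_pdf_le _ _) _.
  rewrite /C ler_wpM2l ?mulr_ge0 ?expR_ge0//.
  by apply: lerD; exact: normal_pdf_ub (oner_neq0 _).
- exact: cvg_cst.
- rewrite -[X in _ --> X](mulr0 C); apply: cvgMr.
  apply/gtr0_cvgV0; last exact: cvgr_idn.
  by exists 1%N => // k /= k1; rewrite ltr0n.
Qed.

Let continuous_Xn_phi n : continuous (fun x : R => x ^+ n * phi x).
Proof.
move=> x; apply: cvgM; first exact: exprn_continuous.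
exact: (@continuous_normal_pdf R 0 1 (oner_neq0 _)).
Qed.

(** Zero for odd [n], and the double factorial of [n - 1] for even [n]. *)
Fixpoint gauss_moment (n : nat) : R :=
  match n with
  | 0 => 1
  | 1 => 0
  | n'.+2 => n'.+1%:R * gauss_moment n'
  end.

Lemma integral_Xn_normal_pdf n :
  (\int[mu]_x (x ^+ n * phi x)%:E = (gauss_moment n)%:E)%E.
Proof.
(* Integration by parts: the derivative of [x ^+ k * phi x] has integral zero. For [k = 0] the
   truncated exponent [k.-1] meets the coefficient 0. *)
have stein k : (\int[mu]_x (x ^+ k.+1 * phi x)%:E =
    k%:R%:E * \int[mu]_x (x ^+ k.-1 * phi x)%:E)%E.
  pose F (x : R) := x ^+ k * phi x.
  pose f (x : R) := k%:R * (x ^+ k.-1 * phi x) - x ^+ k.+1 * phi x.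
  have i1 : mu.-integrable setT (fun x => k%:R%:E * (x ^+ k.-1 * phi x)%:E)%E.
    by apply: integrableZl => //; exact: integrable_Xn_normal_pdf.
  have i2 := integrable_Xn_normal_pdf k.+1.
  have : (\int[mu]_x (f x)%:E = 0)%E.
    apply: (@integral_derivative0 _ F).
    - move=> x; have dX := is_deriveX k (is_derive_id x 1).
      rewrite (_ : F = (id : R -> R) ^+ k * phi); last first.
        by apply/funext => y; rewrite mulrfctE exprfctE.
      apply: is_derive_eq (is_deriveM dX (is_derive_phi x)) _.
      by rewrite exprfctE /f /GRing.scale/= exprS; ring.
    - move=> x; apply: cvgB; last exact: continuous_Xn_phi.
      by apply: cvgMr; exact: continuous_Xn_phi.
    - rewrite (_ : _ \o _ = (fun x => k%:R%:E * (x ^+ k.-1 * phi x)%:E -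
        (x ^+ k.+1 * phi x)%:E)%E)//.
      exact: integrableB.
    - by apply: (@cvg_Xn_phi k (fun n => n%:R)) => m; rewrite normr_nat.
    - by apply: (@cvg_Xn_phi k (fun n => - n%:R)) => m; rewrite normrN normr_nat.
  under eq_integral do rewrite EFinB EFinM.
  rewrite integralB// integralZl//; last exact: integrable_Xn_normal_pdf.
  have := integrable_fin_num measurableT (integrable_Xn_normal_pdf k.-1).
  have := integrable_fin_num measurableT i2.
  move=> /fineK <- /fineK <-; rewrite -EFinM -EFinB => -[] /eqP.
  by rewrite subr_eq0 => /eqP ->.
elim/ltn_ind: n => -[|[|n]] IH /=.
- rewrite -[RHS](integral_normal_pdf (0:R) 1).
  by apply: eq_integral => x _; rewrite expr0 mul1r.
- by rewrite stein mul0e.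
- by rewrite stein IH// EFinM.
Qed.

End normal_moments.

(** * Moments of independent Gaussian variables *)

Section has_mean.
Context d (T : measurableType d) (R : realType) (P : probability T R).
Implicit Types (f g : T -> R) (a b : R).

(** Keeping integrability together with a real value lets means be combined by real arithmetic, free
    of extended-real side conditions. *)
Definition has_mean f a :=
  P.-integrable setT (EFin \o f) /\ (\int[P]_w (f w)%:E = a%:E)%E.

Lemma has_mean_cst a : has_mean (fun=> a) a.
Proof.
split; first exact: finite_measure_integrable_cst.
by rewrite integral_cst//= (probability_setT P) mule1.
Qed.

Lemma has_meanD f g a b : has_mean f a -> has_mean g b ->
  has_mean (fun w => f w + g w) (a + b).
Proof.
move=> [fi fa] [gi gb]; split.
  rewrite (_ : _ \o _ = (EFin \o f) \+ (EFin \o g))%E//; exact: integrableD.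
under eq_integral do rewrite EFinD.
by rewrite integralD_EFin// fa gb.
Qed.

Lemma has_meanZ f a b : has_mean f a -> has_mean (fun w => b * f w) (b * a).
Proof.
move=> [fi fa]; split.
  rewrite (_ : _ \o _ = (fun w => b%:E * (f w)%:E))%E//; exact: integrableZl.
under eq_integral do rewrite EFinM.
by rewrite integralZl// fa.
Qed.

Lemma has_meanB f g a b : has_mean f a -> has_mean g b ->
  has_mean (fun w => f w - g w) (a - b).
Proof.
move=> fa gb; have := has_meanD fa (has_meanZ (-1) gb).
rewrite mulN1r; congr has_mean.
by apply/funext => w; rewrite mulN1r.
Qed.

Lemma has_mean_sum (J : Type) (r : seq J) (Q : pred J) (f : J -> T -> R)
    (a : J -> R) : (forall j, Q j -> has_mean (f j) (a j)) ->
  has_mean (fun w => \sum_(j <- r | Q j) f j w) (\sum_(j <- r | Q j) a j).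
Proof.
move=> fa; elim: r => [|j r IH].
  rewrite big_nil (_ : (fun _ => _) = fun=> 0); first exact: has_mean_cst.
  by apply/funext => w; rewrite big_nil.
rewrite big_cons.
rewrite (_ : (fun _ => _) = fun w => if Q j then f j w + \sum_(j <- r | Q j) f j w
   else \sum_(j <- r | Q j) f j w); last first.
  by apply/funext => w; rewrite big_cons.
by case: ifP => // Qj; apply: has_meanD => //; exact: fa.
Qed.

Lemma has_mean_uniq f a b : has_mean f a -> has_mean f b -> a = b.
Proof. by move=> [_ fa] [_]; rewrite fa => -[]. Qed.

Lemma has_mean_ge0 f a : has_mean f a -> (forall w, 0 <= f w) -> 0 <= a.
Proof.
move=> [_ fa] f0; rewrite -lee_fin -fa; apply: integral_ge0 => w _.
by rewrite lee_fin.
Qed.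

Lemma has_mean_le f g a b : has_mean f a -> has_mean g b ->
  (forall w, f w <= g w) -> a <= b.
Proof.
move=> fa gb fg; rewrite -subr_ge0; apply: has_mean_ge0 (has_meanB gb fa) _.
by move=> w; rewrite subr_ge0.
Qed.

Lemma has_mean_integrable f : P.-integrable setT (EFin \o f) ->
  exists a, has_mean f a.
Proof.
move=> fi; exists (fine (\int[P]_w (f w)%:E)); split => //.
by rewrite fineK//; exact: integrable_fin_num.
Qed.

Lemma has_mean_indic (A : set T) : measurable A -> has_mean \1_A (fine (P A)).
Proof.
move=> mA; split; last by rewrite integral_indic// setIT fineK// fin_num_measure.
apply/integrableP; split; first exact/measurable_EFinP.
under eq_integral do rewrite abse_EFin ger0_norm//.
by rewrite integral_indic// setIT -ge0_fin_numE// fin_num_measure.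
Qed.

Context (I : finType) (X : I -> {RV P >-> R}).
Hypothesis indep : mutually_independent X.

Let mX i : measurable_fun setT (X i). Proof. exact: measurable_funP. Qed.

(** Induction on a list outside of which every [g i] is an indicator. With all factors indicators,
    this is the definition of independence; one general factor is then restored at a time by
    [integral_transfer]. *)
Let has_mean_prod_ge0 (g : I -> R -> R) (m : I -> R) :
  (forall i, measurable_fun setT (g i)) -> (forall i x, 0 <= g i x) ->
  (forall i, has_mean (fun w => g i (X i w)) (m i)) ->
  has_mean (fun w => \prod_i g i (X i w)) (\prod_i m i).
Proof.
have [s indic_out] : exists s : seq I, forall i, i \notin s ->
    exists2 B, measurable B & g i = \1_B.
  by exists (enum I) => i; rewrite mem_enum.
elim: s g m indic_out => [|i s IH] g m indic_out mg g0 gm.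
  have {}indic_out i : exists B, measurable B /\ g i = \1_B.
    by have [//|B] := indic_out i; exists B.
  have [B BE] := choice indic_out.
  have mB i : measurable (B i) by have [] := BE i.
  have mXB i : measurable (X i @^-1` B i).
    by rewrite -[X in measurable X]setTI; exact: mX.
  have := indep [set: I]%SET mB.
  set C := \bigcap_(i in _) _ => PC.
  have mC : measurable C.
    by apply: fin_bigcap_measurable => //; exact: finite_finset.
  have -> : (fun w => \prod_i g i (X i w)) = \1_C.
    apply/funext => w; rewrite indicE; have [wC|wC] := boolP (w \in C).
      rewrite big1// => i _; have [_ ->] := BE i; rewrite indicE mem_set//.
      by move: wC; rewrite inE; apply; rewrite /= inE.
    have [i wi] : exists i, ~ B i (X i w).
      apply/existsNP => wB; move/negP: wC; apply; rewrite inE => i _.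
      exact: wB.
    rewrite (bigD1 i)//=; have [_ ->] := BE i.
    by rewrite indicE memNset ?mul0r.
  have mE i : m i = fine (P (X i @^-1` B i)).
    apply: has_mean_uniq (gm i) _; have [_ ->] := BE i.
    exact: has_mean_indic (mXB i).
  rewrite (_ : \prod_i m i = fine (P C)); first exact: has_mean_indic.
  rewrite PC; under [in RHS]eq_bigl do rewrite finset.in_setT.
  rewrite (eq_bigr (fun i => (m i)%:E)); last first.
    by move=> i _; rewrite mE fineK// fin_num_measure.
  by rewrite prodEFin.
pose H w := \prod_(j | j != i) g j (X j w).
pose c := \prod_(j | j != i) m j.
have m0 j : 0 <= m j by apply: has_mean_ge0 (gm j) _ => w; exact: g0.
have step (f : R -> R) w :
    f (X i w) * H w = \prod_j (if j == i then f else g j) (X j w).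
  rewrite (bigD1 i)//= eqxx; congr (_ * _).
  by apply: eq_bigr => j /negPf ->.
(* With [g i] replaced by an indicator the induction hypothesis applies; it shows that the weights
   [H] and [c] agree on every set defined by [X i]. *)
have indic_case (A : set R) : measurable A ->
    (\int[P]_w (\1_A (X i w) * H w)%:E = \int[P]_w (\1_A (X i w) * c)%:E)%E.
  move=> mA.
  have mXA : measurable (X i @^-1` A).
    by rewrite -[X in measurable X]setTI; exact: mX.
  have IA : has_mean (fun w => \1_A (X i w)) (fine (P (X i @^-1` A))).
    exact: has_mean_indic mXA.
  pose a := fine (P (X i @^-1` A)).
  have [|||j|] := IH (fun j => if j == i then \1_A else g j)
      (fun j => if j == i then a else m j).
  - move=> j js; case: eqVneq => [_|ji]; first by exists A.
    by apply: indic_out; rewrite inE negb_or ji.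
  - by move=> j; case: ifP => // _; exact: measurable_indic.
  - by move=> j x; case: ifP.
  - by case: eqVneq => [->|_].
  move=> _ eqI; under eq_integral do rewrite step.
  rewrite eqI; have [_] := has_meanZ c IA; under eq_integral do rewrite mulrC; move=> ->.
  congr EFin; rewrite (bigD1 i)//= eqxx mulrC; congr (_ * _).
  by apply: eq_bigr => j /negPf ->.
have intc : P.-integrable setT (fun w => (g i (X i w) * c)%:E).
  have [+ _] := has_meanZ c (gm i); congr (_.-integrable _ _).
  by apply/funext => w /=; rewrite mulrC.
have mH : measurable_fun setT H.
  rewrite /H.
  under eq_fun do rewrite -big_filter.
  by apply: measurable_prod => j _; exact: measurableT_comp.
have H0 w : 0 <= H w by apply: prodr_ge0.
have c0 (_ : T) : 0 <= c by apply: prodr_ge0.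
have [] := @integral_transfer _ _ _ _ _ _ R P P (X i) (X i) H (fun=> c)
  (mX i) (mX i) mH (measurable_cst _) H0 c0 indic_case (g i) (mg i) intc.
have -> : (fun w => \prod_i g i (X i w)) = fun w => g i (X i w) * H w.
  by apply/funext => w; rewrite (bigD1 i).
move=> intH eqH; split => //.
rewrite eqH (bigD1 i)//= mulrC.
by have [_ <-] := has_meanZ c (gm i); apply: eq_integral => w _; rewrite mulrC.
Qed.

(** Induction on a list outside of which every factor is nonnegative; the factor at hand is split
    into its positive and negative parts. *)
Lemma has_mean_prod (g : I -> R -> R) (m : I -> R) :
  (forall i, measurable_fun setT (g i)) ->
  (forall i, has_mean (fun w => g i (X i w)) (m i)) ->
  has_mean (fun w => \prod_i g i (X i w)) (\prod_i m i).
Proof.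
have [s ge0_out] : exists s : seq I, forall i x, i \notin s -> 0 <= g i x.
  by exists (enum I) => i x; rewrite mem_enum.
elim: s g m ge0_out => [|i s IH] g m ge0_out mg gm.
  by apply: has_mean_prod_ge0 => // i x; exact: ge0_out.
pose g1 x := Num.max (g i x) 0; pose g2 x := Num.max (- g i x) 0.
have gE x : g i x = g1 x - g2 x.
  rewrite /g1 /g2; have [gi0|/ltW gi0] : 0 <= g i x \/ g i x < 0 by apply/orP; rewrite leNgt orNb.
    by rewrite max_l// max_r ?subr0// oppr_le0.
  by rewrite max_r// max_l ?sub0r ?opprK// oppr_ge0.
have mg1 : measurable_fun setT g1 by exact: measurable_maxr.
have mg2 : measurable_fun setT g2.
  by apply: measurable_maxr => //; exact: measurableT_comp.
have intg (f : R -> R) : measurable_fun setT f ->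
    (forall x, `|f x| <= `|g i x|) -> P.-integrable setT (fun w => (f (X i w))%:E).
  move=> mf fg; have [gi _] := gm i; apply: le_integrable gi => //.
    by apply/measurable_EFinP; exact: measurableT_comp.
  by move=> w _; rewrite !abse_EFin lee_fin.
have [|m1 hm1] := @has_mean_integrable (g1 \o X i).
  apply: intg => // x; rewrite /g1.
  have [gi0|/ltW gi0] : 0 <= g i x \/ g i x < 0 by apply/orP; rewrite leNgt orNb.
    by rewrite max_l.
  by rewrite max_r ?normr0.
have [|m2 hm2] := @has_mean_integrable (g2 \o X i).
  apply: intg => // x; rewrite /g2.
  have [gi0|/ltW gi0] : 0 <= - g i x \/ - g i x < 0 by apply/orP; rewrite leNgt orNb.
    by rewrite max_l// normrN.
  by rewrite max_r ?normr0.
have mE : m i = m1 - m2.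
  apply: has_mean_uniq (gm i) _; have := has_meanB hm1 hm2; congr has_mean.
  by apply/funext => w; rewrite /= -gE.
have step (f : R -> R) a : measurable_fun setT f -> (forall x, 0 <= f x) ->
    has_mean (f \o X i) a ->
    has_mean (fun w => f (X i w) * \prod_(j | j != i) g j (X j w))
             (a * \prod_(j | j != i) m j).
  move=> mf f0 fa.
  have := IH (fun j => if j == i then f else g j) (fun j => if j == i then a else m j).
  rewrite (bigD1 i)//= eqxx (eq_bigr m); last by move=> j /negPf ->.
  rewrite (_ : (fun _ => _) = fun w => f (X i w) * \prod_(j | j != i) g j (X j w)); last first.
    apply/funext => w; rewrite (bigD1 i)//= eqxx; congr (_ * _).
    by apply: eq_bigr => j /negPf ->.
  apply.
  - move=> j x js; case: eqVneq => // ji; apply: ge0_out.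
    by rewrite inE negb_or ji.
  - by move=> j; case: ifP.
  - by move=> j; case: eqVneq => [->|_].
have g10 x : 0 <= g1 x by rewrite le_max lexx orbT.
have g20 x : 0 <= g2 x by rewrite le_max lexx orbT.
have := has_meanB (step g1 m1 mg1 g10 hm1) (step g2 m2 mg2 g20 hm2).
rewrite -mulrBl -mE => H; rewrite [X in has_mean _ X](bigD1 i)//=.
have -> : (fun w => \prod_i g i (X i w)) =
    (fun w => g1 (X i w) * \prod_(j | j != i) g j (X j w) -
              g2 (X i w) * \prod_(j | j != i) g j (X j w)).
  by apply/funext => w; rewrite -mulrBl -gE (bigD1 i).
by [].
Qed.

End has_mean.

(** * Gaussian expectation of polynomials and Hermite calculus *)

Section gauss_functional.
Context {R : realType}.
Implicit Types p q : {poly R}.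
Local Notation gm := (@gauss_moment R).

Definition gaussE p := \sum_(i < size p) p`_i * gm i.

Lemma gaussE_wide n p : (size p <= n)%N -> gaussE p = \sum_(i < n) p`_i * gm i.
Proof.
move=> pn; rewrite /gaussE (big_ord_widen n (fun i => p`_i * gm i))// big_mkcond.
by apply: eq_bigr => i _; case: ltnP => // ip; rewrite nth_default// mul0r.
Qed.

Lemma gaussE_is_linear : linear_for *%R gaussE.
Proof.
move=> a p q; pose n := maxn (size p) (size q).
have pn : (size p <= n)%N by exact: leq_maxl.
have qn : (size q <= n)%N by exact: leq_maxr.
rewrite (@gaussE_wide n (a *: p + q)); last first.
  rewrite (leq_trans (size_polyD _ _))// geq_max qn andbT.
  exact: leq_trans (size_scale_leq _ _) pn.
rewrite (gaussE_wide pn) (gaussE_wide qn) mulr_sumr -big_split/=.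
by apply: eq_bigr => i _; rewrite coefD coefZ mulrDl mulrA.
Qed.
HB.instance Definition _ := GRing.isLinear.Build R {poly R} R _ gaussE gaussE_is_linear.

Lemma gaussE_Xn n : gaussE 'X^n = gm n.
Proof.
rewrite /gaussE size_polyXn big_ord_recr/= coefXn eqxx mul1r big1 ?add0r// => i _.
by rewrite coefXn ltn_eqF ?mul0r.
Qed.

Lemma gaussE1 : gaussE 1 = 1. Proof. by rewrite -(expr0 'X) gaussE_Xn. Qed.

(** Stein's identity, which on monomials is the recursion of [gauss_moment]. *)
Lemma gaussE_mulX p : gaussE ('X * p) = gaussE p^`().
Proof.
rewrite -[p]coefK poly_def mulr_sumr raddf_sum !linear_sum/=.
apply: eq_bigr => i _; rewrite -scalerAr derivZ !linearZ/= -exprS derivXn linearMn/=.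
rewrite !gaussE_Xn; congr (_ * _).
by case: (nat_of_ord i) => [|k]; rewrite ?mulr0n//= mulr_natl.
Qed.

Fixpoint hermite (n : nat) : {poly R} :=
  if n is n'.+1 then 'X * hermite n' - (hermite n')^`() else 1.

(** Iterated Stein identity: by the product rule, the derivative falling on the Hermite factor
    cancels the subtracted term of its recursion. *)
Lemma gaussE_hermite n p : gaussE (hermite n * p) = gaussE p^`(n).
Proof.
elim: n p => [|n IH] p /=; first by rewrite mul1r.
rewrite mulrBl linearB/= -mulrA gaussE_mulX derivM linearD/= [X in X - _]addrC.
by rewrite addrK IH -derivSn.
Qed.

Lemma deriv_hermite n : (hermite n.+1)^`() = n.+1%:R *: hermite n.
Proof.
elim: n => [|n IH]; first by rewrite /= mulr1 derivB derivX !derivC subr0 scale1r.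
rewrite -[hermite n.+2]/('X * hermite n.+1 - (hermite n.+1)^`()) derivB derivM derivX.
rewrite mul1r !IH derivZ -scalerAr -addrA -scalerBr.
by rewrite [in RHS]mulrS scalerDl scale1r.
Qed.

Lemma derivn_hermite n k : (hermite n)^`(k) = (n ^_ k)%:R *: hermite (n - k).
Proof.
elim: k n => [|k IH] n; first by rewrite derivn0 ffactn0 scale1r subn0.
case: n => [|n]; first by rewrite derivSn derivC linear0 ffact0n scale0r.
by rewrite derivSn deriv_hermite derivnZ IH scalerA -natrM ffactnS.
Qed.

Lemma gaussE_hermite_eq0 n : gaussE (hermite n) = (n == 0)%:R.
Proof.
case: n => [|n]; first exact: gaussE1.
by rewrite -[hermite _]mulr1 gaussE_hermite derivSn derivC linear0 linear0.
Qed.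

Lemma gaussE_hermiteM m n :
  gaussE (hermite m * hermite n) = (m == n)%:R * m`!%:R.
Proof.
rewrite gaussE_hermite derivn_hermite linearZ/= gaussE_hermite_eq0 subn_eq0.
case: (ltngtP m n) => [mn|mn|->]; rewrite ?mulr0 ?mul0r//.
  by rewrite ffact_small// mul0r.
by rewrite ffactnn mulr1 mul1r.
Qed.

(** The left side is the [k]-th derivative in [u] of [E (Z + u)^a], here expanded in powers of [u].
    The factor ['C(a, b) * gm (a - b)] is free of [k], and the range up to [m] lets all coordinates
    share one index type. *)
Lemma gaussE_hermite_shift k a m (u : R) : (a <= m)%N ->
  gaussE (hermite k * ('X + u%:P) ^+ a) =
  \sum_(b < m.+1) 'C(a, b)%:R * gm (a - b) * (k`!%:R * 'C(b, k)%:R * u ^+ (b - k)).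
Proof.
move=> am; rewrite gaussE_hermite.
have -> : (('X + u%:P) ^+ a)^`(k) = (a ^_ k)%:R *: ('X + u%:P) ^+ (a - k).
  elim: k => [|k IH]; first by rewrite derivn0 ffactn0 scale1r subn0.
  rewrite derivnS IH derivZ deriv_exp derivD derivX derivC addr0 ?mulr1 ?mul1r.
  by rewrite -[_ *+ (a - k)]scaler_nat scalerA -natrM -subnS ffactnSr.
rewrite linearZ/=; have [ak|ka] := ltnP a k.
  rewrite ffact_small// mul0r big1// => b _; have [ba|ab] := leqP b a.
    by rewrite (bin_small (leq_ltn_trans ba ak)) mulr0 mul0r mulr0.
  by rewrite bin_small// !mul0r.
pose F b := 'C(a, b)%:R * gm (a - b) * (k`!%:R * 'C(b, k)%:R * u ^+ (b - k)).
rewrite -(big_mkord xpredT F) (big_cat_nat (n := k))//=; last first.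
  exact: leq_trans (leq_trans ka am) _.
rewrite big_nat big1 ?add0r => [|b bk]; last first.
  by rewrite /F (@bin_small b)// mulr0 mul0r mulr0.
rewrite (big_cat_nat (n := a.+1))//=; last exact: leqW.
rewrite [X in _ = _ + X]big_nat [X in _ = _ + X]big1 ?addr0 => [|b /andP[ab _]]; last first.
  by rewrite /F bin_small// !mul0r.
rewrite exprDn linear_sum mulr_sumr/= -[X in _ = bigop _ (index_iota X _) _]add0n.
rewrite big_addn big_mkord subSn//.
apply: eq_bigr => i _; rewrite linearMn/= -polyC_exp ['X^_ * _]mulrC mul_polyC linearZ/= gaussE_Xn.
rewrite /F addnK [(i + k)%N]addnC subnDA -[(_ * _) *+ _]mulr_natl [LHS]mulrA -[X in X * _]natrM.
(* Both sides equal [a! / (i! (a - k - i)!)]. *)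
have -> : (a ^_ k * 'C(a - k, i) = 'C(a, k + i) * k`! * 'C(k + i, k))%N.
  have le_i : (i <= a - k)%N by rewrite -ltnS.
  have le_ki : (k + i <= a)%N by rewrite -leq_subRL.
  have pos : (0 < i`! * (a - k - i)`!)%N by rewrite muln_gt0 !fact_gt0.
  have := bin_fact (leq_addr i k); rewrite addKn => kiE.
  have := bin_fact le_ki; rewrite subnDA => aE.
  apply/eqP; rewrite -(eqn_pmul2r pos) -mulnA (bin_fact le_i) (ffact_fact ka).
  rewrite -aE -kiE; apply/eqP; ring.
rewrite !natrM; ring.
Qed.

End gauss_functional.

(** * The dual certificate *)

Section certificate.
Context d (T : measurableType d) (R : realType) (P : probability T R).
Context (I : finType) (E : I -> {RV P >-> R}).
Hypothesis iidE : iid_standard_normal E.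

Let has_mean_Xn i n : has_mean P (fun w => E i w ^+ n) (gauss_moment n).
Proof.
have [_ lawE] := iidE.
have mE : measurable_fun setT (E i) by exact: measurable_funP.
have mX : measurable_fun setT (fun y : R => y ^+ n) by exact: measurable_funX.
have := @integral_transfer _ _ _ _ _ _ R P (@lebesgue_measure R) (E i) id (fun=> 1)
  (normal_pdf 0 1) mE (@measurable_id _ _ _)
  (measurable_cst _) (measurable_normal_pdf 0 1) (fun=> ler01)
  (normal_pdf_ge0 0 1) _ (fun y => y ^+ n) mX (integrable_Xn_normal_pdf n).
case.
  move=> A mA; have mEA : measurable (E i @^-1` A).
    by rewrite -[X in measurable X]setTI; exact: measurable_funP.
  under eq_integral do rewrite mulr1.
  have [_ ->] := has_mean_indic P mEA; rewrite fineK ?fin_num_measure//.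
  transitivity (distribution P (E i) A) => //; rewrite lawE// /normal_prob [LHS]integral_mkcond.
  apply: eq_integral => x _.
  by rewrite patchE indicE; case: ifP; rewrite ?mul1r ?mul0r.
rewrite integral_Xn_normal_pdf; under eq_integral do rewrite mulr1.
move=> int intE; split => //.
by move: int; congr (_.-integrable _ _); apply/funext => w; rewrite mulr1.
Qed.

Let has_mean_poly i (p : {poly R}) :
  has_mean P (fun w => p.[E i w]) (gaussE p).
Proof.
have := has_mean_sum (index_enum _) (fun (j : 'I_(size p)) (_ : true) =>
  has_meanZ p`_j (has_mean_Xn i j)).
by congr has_mean; apply/funext => w; rewrite horner_coef.
Qed.

Lemma has_mean_prod_poly (p : I -> {poly R}) :
  has_mean P (fun w => \prod_i (p i).[E i w]) (\prod_i gaussE (p i)).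
Proof.
have [indep _] := iidE.
apply: (has_mean_prod indep (g := fun i x => (p i).[x])) => i.
  by apply: continuous_measurable_fun; exact: continuous_horner.
exact: has_mean_poly.
Qed.

Variables (D : nat) (L : finType) (X : L -> I -> R) (x : L -> R).

Definition prior_moment (y : L -> R) (f : I -> nat) : R :=
  #|L|%:R^-1 * \sum_g y g * \prod_i X g i ^+ f i.

Variable kappa : {ffun I -> 'I_D.+1} -> R.
Hypothesis L_gt0 : (0 < #|L|)%N.
Hypothesis kappaE : forall b : {ffun I -> 'I_D.+1}, (mdegree b <= D)%N ->
  prior_moment x (fun i => b i) =
  \sum_a (mbin b a)%:R * kappa a * prior_moment (fun=> 1) (fun i => b i - a i)%N.

(** The signal [x] and the noise polynomial [W] correlate equally with every monomial of degree at
    most [D] in the observation. Both sides expand over [c] with the same weight [wt c], and the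
    coefficients agree by the moment-cumulant formula. *)
Let sum_shift (a : I -> nat) : (\sum_i a i <= D)%N ->
  \sum_g x g * \prod_i gaussE (('X + (X g i)%:P) ^+ a i) =
  \sum_g \sum_(b : {ffun I -> 'I_D.+1} | (mdegree b <= D)%N) kappa b / (mfact b)%:R *
     \prod_i gaussE (hermite (b i) * ('X + (X g i)%:P) ^+ a i).
Proof.
move=> aD.
have ai i : (a i <= D)%N by apply: leq_trans aD; rewrite (bigD1 i)//= leq_addr.
pose wt (b : {ffun I -> 'I_D.+1}) : R :=
  \prod_i ('C(a i, b i)%:R * gauss_moment (a i - b i)).
have wt_le b : wt b != 0 -> forall i, (b i <= a i)%N.
  move=> + i; apply: contraNT; rewrite -ltnNge => ab.
  by rewrite /wt (bigD1 i)//= bin_small// !mul0r.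
have shiftE g (b : {ffun I -> 'I_D.+1}) :
    \prod_i gaussE (hermite (b i) * ('X + (X g i)%:P) ^+ a i) =
    \sum_(c : {ffun I -> 'I_D.+1}) wt c * (mfact b)%:R * (mbin c b)%:R *
       \prod_i X g i ^+ (c i - b i).
  under eq_bigr do rewrite (gaussE_hermite_shift _ _ (ai _)).
  rewrite bigA_distr_bigA/=; apply: eq_bigr => c _.
  by rewrite /wt /mfact /mbin !natr_prod -!big_split/=; apply: eq_bigr => i _; ring.
have L0 : #|L|%:R != 0 :> R by rewrite pnatr_eq0 -lt0n.
have pmE y f : \sum_g y g * \prod_i X g i ^+ f i = #|L|%:R * prior_moment y f.
  by rewrite /prior_moment mulVKf.
transitivity (\sum_(c : {ffun I -> 'I_D.+1})
    wt c * (#|L|%:R * prior_moment x (fun i => c i))).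
  under [RHS]eq_bigr do rewrite -pmE mulr_sumr.
  rewrite exchange_big/=; apply: eq_bigr => g _.
  have := shiftE g [ffun=> ord0]; under eq_bigr do rewrite ffunE mul1r.
  move=> ->; rewrite mulr_sumr; apply: eq_bigr => c _.
  have -> : mfact ([ffun=> ord0] : {ffun I -> 'I_D.+1}) = 1%N.
    by rewrite /mfact big1// => i _; rewrite ffunE.
  have -> : mbin c [ffun=> ord0] = 1%N.
    by rewrite /mbin big1// => i _; rewrite ffunE bin0.
  rewrite !mulr1 mulrCA; congr (_ * (_ * _)).
  by apply: eq_bigr => i _; rewrite ffunE subn0.
transitivity (\sum_(c : {ffun I -> 'I_D.+1})
   \sum_(b : {ffun I -> 'I_D.+1} | (mdegree b <= D)%N) wt c *
   (#|L|%:R * ((mbin c b)%:R * kappa b * prior_moment (fun=> 1) (fun i => c i - b i)%N))).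
  (* A nonzero [wt c] forces [c] below [a], so [kappaE] is available; a nonzero [mbin c b] then
     forces [b] to have degree at most [D], so the truncation loses nothing. *)
  apply: eq_bigr => c _; have [->|wc] := eqVneq (wt c) 0.
    by rewrite mul0r big1// => b _; rewrite mul0r.
  have cD : (mdegree c <= D)%N.
    by apply: leq_trans aD; apply: leq_sum => i _; exact: wt_le.
  rewrite kappaE// -!mulr_sumr; congr (_ * (_ * _)).
  rewrite [RHS]big_mkcond; apply: eq_bigr => b _; case: ifPn => // bD.
  have [->|cb] := eqVneq (mbin c b) 0%N; first by rewrite !mul0r.
  move/negP: bD; case; apply: leq_trans cD.
  by apply: leq_sum => i _; exact: mbin_neq0 cb i.
rewrite exchange_big/= [RHS]exchange_big/=; apply: eq_bigr => b _.
under [RHS]eq_bigr do rewrite shiftE mulr_sumr.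
rewrite [RHS]exchange_big/=; apply: eq_bigr => c _.
have b0 : (mfact b)%:R != 0 :> R.
  by rewrite pnatr_eq0 -lt0n prodn_gt0// => i; exact: fact_gt0.
rewrite mulrA [in RHS](eq_bigr (fun g => wt c * (mbin c b)%:R * kappa b *
    (1 * \prod_i X g i ^+ (c i - b i)))); last first.
  by move=> g _; field.
by rewrite -mulr_sumr (pmE (fun=> 1)); ring.
Qed.

(** The tangent inequality for the square at [W - x] bounds the error below by [x ^+ 2 - W ^+ 2]
    plus a multiple of [f * (W - x)]. The latter averages to zero over the prior, and [W] has second
    moment [EWW] by Hermite orthogonality. *)
Lemma low_degree_certificate (J : Type) (s : seq J) (c : J -> R) (a : J -> I -> nat) :
  (forall j, (\sum_i a j i <= D)%N) ->
  exists2 r : L -> R,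
    forall g, has_mean P (fun w =>
      (\sum_(j <- s) c j * \prod_i (E i w + X g i) ^+ a j i - x g) ^+ 2) (r g) &
    \sum_g x g ^+ 2 - #|L|%:R *
      \sum_(b : {ffun I -> 'I_D.+1} | (mdegree b <= D)%N) kappa b ^+ 2 / (mfact b)%:R
    <= \sum_g r g.
Proof.
move=> aD.
pose f g w := \sum_(j <- s) c j * \prod_i (E i w + X g i) ^+ a j i.
pose W w := \sum_(b : {ffun I -> 'I_D.+1} | (mdegree b <= D)%N)
   kappa b / (mfact b)%:R * \prod_i (hermite (b i)).[E i w].
pose Ef g := \sum_(j <- s) c j * \prod_i gaussE (('X + (X g i)%:P) ^+ a j i).
pose EfW g := \sum_(j <- s) \sum_(b : {ffun I -> 'I_D.+1} | (mdegree b <= D)%N)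
   (c j * (kappa b / (mfact b)%:R)) *
   \prod_i gaussE (hermite (b i) * ('X + (X g i)%:P) ^+ a j i).
pose EW := \sum_(b : {ffun I -> 'I_D.+1} | (mdegree b <= D)%N)
   kappa b / (mfact b)%:R * \prod_i gaussE (hermite (b i)).
pose EWW := \sum_(b : {ffun I -> 'I_D.+1} | (mdegree b <= D)%N) kappa b ^+ 2 / (mfact b)%:R.
have hf g : has_mean P (f g) (Ef g).
  apply: has_mean_sum => j _; apply: has_meanZ.
  have := has_mean_prod_poly (fun i => ('X + (X g i)%:P) ^+ a j i).
  by congr has_mean; apply/funext => w; apply: eq_bigr => i _; rewrite !hornerE.
have hW : has_mean P W EW.
  by apply: has_mean_sum => b _; apply: has_meanZ; exact: has_mean_prod_poly.
have hfW g : has_mean P (fun w => f g w * W w) (EfW g).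
  have : has_mean P (fun w => \sum_(j <- s)
     \sum_(b : {ffun I -> 'I_D.+1} | (mdegree b <= D)%N)
     (c j * (kappa b / (mfact b)%:R)) *
     \prod_i (hermite (b i) * ('X + (X g i)%:P) ^+ a j i).[E i w]) (EfW g).
    apply: has_mean_sum => j _; apply: has_mean_sum => b _; apply: has_meanZ.
    exact: has_mean_prod_poly.
  congr has_mean; apply/funext => w; rewrite /f mulr_suml; apply: eq_bigr => j _.
  rewrite /W mulr_sumr; apply: eq_bigr => b _.
  under eq_bigr do rewrite hornerM.
  rewrite big_split/= [RHS]mulrACA; congr (_ * _).
  by rewrite mulrC; congr (_ * _); apply: eq_bigr => i _; rewrite !hornerE.
have hWW : has_mean P (fun w => W w ^+ 2) EWW.
  have : has_mean P (fun w => \sum_(b : {ffun I -> 'I_D.+1} | (mdegree b <= D)%N)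
     \sum_(b' : {ffun I -> 'I_D.+1} | (mdegree b' <= D)%N)
     (kappa b / (mfact b)%:R * (kappa b' / (mfact b')%:R)) *
     \prod_i (hermite (b i) * hermite (b' i)).[E i w]) EWW.
    rewrite /EWW; have -> : \sum_(b : {ffun I -> 'I_D.+1} | (mdegree b <= D)%N)
        kappa b ^+ 2 / (mfact b)%:R =
        \sum_(b : {ffun I -> 'I_D.+1} | (mdegree b <= D)%N)
        \sum_(b' : {ffun I -> 'I_D.+1} | (mdegree b' <= D)%N)
        (kappa b / (mfact b)%:R * (kappa b' / (mfact b')%:R)) *
        \prod_i gaussE (hermite (b i) * hermite (b' i)).
      apply: eq_bigr => b bD; rewrite (bigD1 b)//= [X in _ + X]big1 ?addr0; last first.
        move=> b' /andP[_ bb'].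
        have [i bi] : exists i, b i != b' i.
          apply/existsP; apply: contraNT bb'; rewrite negb_exists => /forallP bb'.
          by apply/eqP/ffunP => i; apply/eqP; have := bb' i; rewrite negbK eq_sym.
        rewrite (bigD1 i)//= gaussE_hermiteM (_ : (b i == b' i :> nat) = false).
          by rewrite !mul0r mulr0.
        exact: negbTE.
      rewrite (eq_bigr (fun i => (b i)`!%:R)); last first.
        by move=> i _; rewrite gaussE_hermiteM eqxx mul1r.
      rewrite -natr_prod -/(mfact b).
      have b0 : (mfact b)%:R != 0 :> R.
        by rewrite pnatr_eq0 -lt0n prodn_gt0// => i; exact: fact_gt0.
      by field.
    apply: has_mean_sum => b _; apply: has_mean_sum => b' _; apply: has_meanZ.
    exact: has_mean_prod_poly.
  congr has_mean; apply/funext => w; rewrite expr2 {1}/W mulr_suml; apply: eq_bigr => b _.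
  rewrite /W mulr_sumr; apply: eq_bigr => b' _.
  under eq_bigr do rewrite hornerM.
  by rewrite big_split/= [RHS]mulrACA.
have [Eff hff] : exists Eff, forall g, has_mean P (fun w => f g w ^+ 2) (Eff g).
  exists (fun g => \sum_(j <- s) \sum_(j' <- s) (c j * c j') *
    \prod_i gaussE (('X + (X g i)%:P) ^+ a j i * ('X + (X g i)%:P) ^+ a j' i)) => g.
  have : has_mean P (fun w => \sum_(j <- s) \sum_(j' <- s) (c j * c j') *
    \prod_i (('X + (X g i)%:P) ^+ a j i * ('X + (X g i)%:P) ^+ a j' i).[E i w])
    (\sum_(j <- s) \sum_(j' <- s) (c j * c j') *
    \prod_i gaussE (('X + (X g i)%:P) ^+ a j i * ('X + (X g i)%:P) ^+ a j' i)).
    apply: has_mean_sum => j _; apply: has_mean_sum => j' _; apply: has_meanZ.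
    exact: has_mean_prod_poly.
  congr has_mean; apply/funext => w; rewrite expr2 {1}/f mulr_suml.
  apply: eq_bigr => j _; rewrite /f mulr_sumr; apply: eq_bigr => j' _.
  rewrite [RHS]mulrACA -big_split/=; congr (_ * _).
  by apply: eq_bigr => i _; rewrite !hornerE.
pose r g := Eff g - 2 * x g * Ef g + x g ^+ 2.
have hr g : has_mean P (fun w => (f g w - x g) ^+ 2) (r g).
  have := has_meanD (has_meanB (hff g) (has_meanZ (2 * x g) (hf g)))
    (has_mean_cst P (x g ^+ 2)).
  by congr has_mean; apply/funext => w; ring.
exists r => //.
have le_r g : 2 * (EfW g - x g * Ef g) + (x g ^+ 2 - EWW) <= r g.
  have lb := has_meanB (has_meanZ 2 (has_meanB (has_meanB (hfW g) (has_meanZ (x g) (hf g)))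
      (has_meanB (has_meanZ (x g) hW) (has_mean_cst P (x g ^+ 2)))))
    (has_meanD (has_meanB hWW (has_meanZ (2 * x g) hW)) (has_mean_cst P (x g ^+ 2))).
  apply: le_trans (has_mean_le lb (hr g) _).
    by rewrite le_eqVlt; apply/orP; left; apply/eqP; ring.
  (* [2 u v - v ^+ 2 <= u ^+ 2] with [u = f - x] and [v = W - x] *)
  move=> w; rewrite -subr_ge0.
  rewrite [leRHS](_ : _ = (f g w - W w) ^+ 2) ?sqr_ge0//; ring.
(* By linearity over the monomials of [f], this reduces to [sum_shift]. *)
have orth : \sum_g (EfW g - x g * Ef g) = 0.
  rewrite big_split/= sumrN /EfW /Ef exchange_big/=.
  under [X in _ - X]eq_bigr do rewrite mulr_sumr.
  rewrite [X in _ - X]exchange_big/= -sumrB big1// => j _.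
  under [X in _ - X]eq_bigr do rewrite mulrCA.
  rewrite -mulr_sumr (sum_shift (aD j)) mulr_sumr.
  apply/eqP; rewrite subr_eq0; apply/eqP/eq_bigr => g _.
  by rewrite mulr_sumr; apply: eq_bigr => b _; rewrite [RHS]mulrA.
have : \sum_g (2 * (EfW g - x g * Ef g) + (x g ^+ 2 - EWW)) <= \sum_g r g.
  by apply: ler_sum => g _; exact: le_r.
apply: le_trans.
rewrite big_split/= -mulr_sumr orth mulr0 add0r big_split/= sumrN.
by rewrite sumr_const mulr_natl.
Qed.

End certificate.

(** Rewrites a polynomial in the vectorised matrix as a sum of monomials indexed by pairs, the form
    that the certificate handles. *)
Lemma poly_estimator_entry (R : realType) (n1 n2 D : nat)
    (Mhat : 'M[R]_(n1, n2) -> 'M[R]_(n1, n2)) (i : 'I_n1) (j : 'I_n2) :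
  poly_estimator D Mhat ->
  exists (s : seq (mpoly.multinom (n1 * n2)))
    (c : mpoly.multinom (n1 * n2) -> R)
    (a : mpoly.multinom (n1 * n2) -> 'I_n1 * 'I_n2 -> nat),
    (forall m, (\sum_e a m e <= D)%N) /\
    forall Y, Mhat Y i j = \sum_(m <- s) c m * \prod_e Y e.1 e.2 ^+ a m e.
Proof.
move=> /(_ i j)[p [pD MhatE]].
pose idx (e : 'I_n1 * 'I_n2) := mxvec_index e.1 e.2.
have idx_bij : {on [pred l : 'I_(n1 * n2) | true], bijective idx}.
  have [h h1 h2] := @curry_mxvec_bij n1 n2.
  by exists h => [[i' j']|l] /= _; [exact: (h1 (i', j'))|have := h2 l isT; case: (h l)].
(* The default 0 makes the degree bound hold for every [m]; on the support of [p] it never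
   occurs. *)
pose a (m : mpoly.multinom (n1 * n2)) e :=
  if (mpoly.mdeg m <= D)%N then mpoly.fun_of_multinom m (idx e) else 0%N.
exists (mpoly.msupp p), (fun m => mpoly.mcoeff m p), a; split=> [m|Y].
  rewrite /a; have [mD|_] := boolP (mpoly.mdeg m <= D)%N; last by rewrite big1.
  by apply: leq_trans mD; rewrite mpoly.mdegE (reindex idx).
rewrite MhatE mpoly.mevalE big_seq [RHS]big_seq.
apply: eq_bigr => m mp; congr (_ * _).
have mD : (mpoly.mdeg m <= D)%N.
  by rewrite -ltnS; apply: leq_trans pD; exact: mpoly.msize_mdeg_lt.
rewrite (reindex idx)//=; apply: eq_bigr => e _.
by rewrite mxvecE /a mD.
Qed.

(** * Risk of polynomial estimators under the block prior *)

Section block_prior_risk.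
Context (R : realType) (n1 n2 k' D : nat) (lam : R).
Context d (T : measurableType d) (P : probability T R).
Variable E : 'I_n1 * 'I_n2 -> {RV P >-> R}.
Hypothesis iidE : iid_standard_normal E.
Local Notation k := k'.+2.
Local Notation labeling := 'rV['I_k]_(n1 + n2).

Definition block_matrix (g : labeling) : 'M[R]_(n1, n2) :=
  \matrix_(i, j) block_entry lam g (i, j).

(** The block values form [lam] times the identity pattern, and labels in Z/k embed into both label
    sets. *)
Lemma block_matrix_biclustering (k1 k2 : nat) g : (k <= k1)%N -> (k <= k2)%N ->
  @biclustering R n1 n2 k1 k2 (block_matrix g).
Proof.
move=> kk1 kk2.
exists (\matrix_(a, b) (lam * (a == b :> nat)%:R)),
  (fun i => widen_ord kk1 (g 0 (lshift n2 i))),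
  (fun j => widen_ord kk2 (g 0 (rshift n1 j))) => i j.
by rewrite !mxE.
Qed.

Variable n : nat.
Hypothesis (n1n : (n1 <= n)%N) (n2n : (n2 <= n)%N).
Hypothesis lam_small : 480 * (lam ^+ 2 * D%:R ^+ 4) <= 1.
Hypothesis lam_small_n : 480 * (lam ^+ 2 * D%:R ^+ 4) * n%:R <= k%:R ^+ 2.
Hypothesis lam_ge0 : 0 <= lam.

Let N_gt0 : (0 < #|{: labeling}|)%N.
Proof. by apply/card_gt0P; exists 0. Qed.

(** The certificate leaves [lam^2 / k - (10 / 9) lam^2 / k^2], and [k >= 2] makes this at least
    [(1 - 5 / 9) lam^2 / k]. *)
Lemma entry_risk_lower_bound (Mhat : 'M[R]_(n1, n2) -> 'M[R]_(n1, n2)) :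
  poly_estimator D Mhat -> forall e : 'I_n1 * 'I_n2,
  exists r : labeling -> R,
    (forall g, has_mean P (fun w =>
       (Mhat (observation E (block_matrix g) w) e.1 e.2 - block_matrix g e.1 e.2) ^+ 2)
       (r g)) /\
    #|{: labeling}|%:R * (4 / 9 * (lam ^+ 2 / k%:R)) <= \sum_g r g.
Proof.
move=> MhatD e0; have [s [c [a [aD MhatE]]]] := poly_estimator_entry e0.1 e0.2 MhatD.
pose amom := rooted_moment lam e0 (@consistent_prob n1 n2 k' R).
pose mom := edge_moment lam (@consistent_prob n1 n2 k' R).
have mom0 (f : 'I_n1 * 'I_n2 -> nat) : (forall e, f e = 0%N) -> mom f = 1.
  move=> f0; apply: edge_moment0 f0; exact: consistent_prob0.
have [|r hr sum_r] := @low_degree_certificate _ _ _ _ _ E iidE D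
  {: labeling} (block_entry lam) (fun g => block_entry lam g e0)
  (cumulant amom mom) N_gt0 _ _ s c a aD.
  move=> b bD; rewrite /prior_moment rooted_momentE -/amom (sum_cumulant _ mom0).
  by apply: eq_bigr => b' _; rewrite edge_momentE.
exists r; split.
  move=> g; have := hr g; congr has_mean; apply/funext => w.
  rewrite MhatE mxE -surjective_pairing; congr ((_ - _) ^+ 2).
  apply: eq_bigr => m _; congr (_ * _); apply: eq_bigr => e _.
  by rewrite !mxE -surjective_pairing addrC.
apply: le_trans sum_r; rewrite sum_sqr_block_entry -mulrBr ler_wpM2l ?ler0n//.
have := sum_sqr_block_cumulant_le e0 n1n n2n lam_small lam_small_n lam_ge0.
rewrite -/amom -/mom; set S := \sum_(_ | _) _.
have -> : lam ^+ 2 / k%:R ^+ 2 = lam ^+ 2 / k%:R * k%:R^-1 by rewrite -mulrA -invfM.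
have : lam ^+ 2 / k%:R * k%:R^-1 <= lam ^+ 2 / k%:R * 2^-1.
  rewrite ler_wpM2l ?mulr_ge0 ?sqr_ge0 ?invr_ge0 ?ler0n//.
  by rewrite lef_pV2 ?posrE ?ltr0n// ler_nat.
by move: (lam ^+ 2 / k%:R) => x; move: (x / k%:R) => y; lra.
Qed.

End block_prior_risk.

Theorem corollary2 (R : realType) :
  exists2 c : R, 0 < c &
  forall n1 n2 k1 k2 D : nat,
    (0 < n1)%N -> (0 < n2)%N -> (0 < k1)%N -> (0 < k2)%N ->
    (2 <= minn k1 k2)%N -> (1 <= D)%N ->
  forall (d : measure_display) (T : measurableType d) (P : probability T R)
    (E : 'I_n1 * 'I_n2 -> {RV P >-> R}),
    iid_standard_normal E ->
    ((c / D%:R ^+ 4 *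
        Num.min ((minn k1 k2)%:R / (maxn n1 n2)%:R) (1 / (minn k1 k2)%:R))%:E
     <= ereal_inf
          [set ereal_sup [set risk E Mhat M | M in @biclustering R n1 n2 k1 k2]
             | Mhat in @poly_estimator R n1 n2 D])%E.
Proof.
(* The product of 4/9 from the entrywise bound and 1/480 from the choice of [lam]. *)
exists (1 / 1080); first by lra.
move=> n1 n2 k1 k2 D n1_gt0 n2_gt0 _ _ k_ge2 D_ge1 d T P E iidE.
case: (minn k1 k2) (geq_minl k1 k2) (geq_minr k1 k2) k_ge2 => [|[|k']] // kk1 kk2 _.
set n := maxn n1 n2; set B := _ * Num.min _ _.
have n_gt0 : 0 < n%:R :> R by rewrite ltr0n leq_max n1_gt0.
have D_gt0 : 0 < D%:R ^+ 4 :> R by rewrite exprn_gt0// ltr0n.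
have k_gt0 : 0 < k'.+2%:R :> R by rewrite ltr0n.
(* The largest signal that both smallness conditions allow: [480 * lam ^+ 2 * D ^ 4 = mu], and
   [mu / k] is the minimum in the claimed rate. *)
pose mu : R := Num.min (k'.+2%:R ^+ 2 / n%:R) 1.
pose lam : R := Num.sqrt (mu / (480 * D%:R ^+ 4)).
have mu_ge0 : 0 <= mu by rewrite le_min ler01 divr_ge0 ?sqr_ge0// ltW.
have lamE : 480 * (lam ^+ 2 * D%:R ^+ 4) = mu.
  rewrite sqr_sqrtr; last by rewrite divr_ge0 ?mulr_ge0// ltW.
  by move: (D%:R ^+ 4) D_gt0 => u u_gt0; field; rewrite gt_eqF.
have BE : B = 4 / 9 * (lam ^+ 2 / k'.+2%:R).
  have -> : lam ^+ 2 = mu / (480 * D%:R ^+ 4).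
    by rewrite -lamE; move: (D%:R ^+ 4) D_gt0 => u u_gt0; field; rewrite gt_eqF.
  have muk : mu / k'.+2%:R = Num.min (k'.+2%:R / n%:R) (1 / k'.+2%:R).
    rewrite minr_pMl ?invr_ge0 ?(ltW k_gt0)//; congr Num.min.
    by rewrite mulrAC expr2 mulfK// gt_eqF.
  rewrite /B -muk; move: (D%:R ^+ 4) (k'.+2%:R) D_gt0 k_gt0 => u v u_gt0 v_gt0.
  by field; rewrite !gt_eqF.
apply: le_ereal_inf_tmp => _ [Mhat MhatD <-].
have lam_small : 480 * (lam ^+ 2 * D%:R ^+ 4) <= 1 by rewrite lamE ge_min lexx orbT.
have lam_small_n : 480 * (lam ^+ 2 * D%:R ^+ 4) * n%:R <= k'.+2%:R ^+ 2.
  by rewrite lamE -ler_pdivlMr// ge_min lexx.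
have := @entry_risk_lower_bound R n1 n2 k' D lam d T P E iidE n (leq_maxl _ _)
  (leq_maxr _ _) lam_small lam_small_n (sqrtr_ge0 _) Mhat MhatD.
move=> /choice[r] r_ok.
pose L := 'rV['I_k'.+2]_(n1 + n2).
pose rk (g : L) : R := (n1 * n2)%:R^-1 * \sum_(i < n1) \sum_(j < n2) r (i, j) g.
have riskE g : risk E Mhat (block_matrix lam g) = (rk g)%:E.
  have [_ <-] : has_mean P (fun w => loss (Mhat (observation E (block_matrix lam g) w))
      (block_matrix lam g)) (rk g).
    apply: has_meanZ; apply: has_mean_sum => i _; apply: has_mean_sum => j _.
    by have [hr _] := r_ok (i, j); exact: hr.
  by rewrite /risk unlock.
have sum_rk : #|{: L}|%:R * B <= \sum_g rk g.
  rewrite /rk -mulr_sumr exchange_big/=.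
  under [X in _ <= _ * X]eq_bigr do rewrite exchange_big/=.
  rewrite ler_pdivlMl ?ltr0n ?muln_gt0 ?n1_gt0//.
  apply: (@le_trans _ _ (\sum_(i < n1) \sum_(j < n2) #|{: L}|%:R * B)).
    by rewrite !sumr_const !card_ord -mulrnA [leLHS]mulr_natl mulnC.
  apply: ler_sum => i _; apply: ler_sum => j _; rewrite BE.
  by have [_] := r_ok (i, j).
(* The worst labeling is at least as bad as the average one; this passes from the prior to the
   supremum. *)
have [g Bg] : exists g, B <= rk g.
  apply/not_existsP => rkB; move: sum_rk; apply/negP; rewrite -ltNge.
  rewrite mulr_natl -sumr_const; apply: ltr_sum => [|g _].
    by apply/hasP; exists 0; rewrite ?mem_index_enum.
  by rewrite ltNge; apply/negP; exact: rkB.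
apply: (@le_trans _ _ (rk g)%:E); first by rewrite lee_fin.
rewrite -riskE; apply: ereal_sup_ubound; exists (block_matrix lam g) => //.
exact: block_matrix_biclustering.
Qed.
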